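(* Let $n\ge 3$ and $\eta\in\mathbb R$, and let $T^*V_{n,2}$ be equipped with the twisted symplectic form $\omega_\eta$. Consider the magnetic geodesic flow (the Hamiltonian flow on $(T^*V_{n,2},\omega_\eta)$) of an $SO(n)$-invariant Riemannian metric $ds^2_a$ with Hamiltonian $H_a$ (for $n=3$: of any $SO(3)$-invariant Riemannian metric $ds^2_b$ with Hamiltonian $H_b$). This flow is completely integrable in the non-commutative sense. The complete algebra of first integrals is generated by the components of the momentum mapping $$\Phi_\eta^{ij}=\langle \Phi_\eta,\mathbf E_i\wedge \mathbf E_j\rangle,\qquad 1\le i<j\le n,$$ and the Hamiltonian function ($H_a$, respectively $H_b$ for $n=3$). For $n\ge 4$ the dimension of the (generic) invariant isotropic manifolds is equal to $3$. For $n=3$ the dimension of the invariant tori is equal to $2$.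
   Context: **Stiefel variety and cotangent bundle.** $V_{n,2}=\{(\mathbf e_1,\mathbf e_2)\in\mathbb R^{n}\times\mathbb R^n : \langle \mathbf e_1,\mathbf e_1\rangle=\langle \mathbf e_2,\mathbf e_2\rangle=1,\ \langle \mathbf e_1,\mathbf e_2\rangle=0\}\cong SO(n)/SO(n-2)$. Its cotangent bundle is realized as the set of $(\mathbf e_1,\mathbf e_2,\mathbf p_1,\mathbf p_2)\in\mathbb R^{4n}$ with $(\mathbf e_1,\mathbf e_2)\in V_{n,2}$ and $\langle \mathbf e_1,\mathbf p_1\rangle=0$, $\langle \mathbf e_2,\mathbf p_2\rangle=0$, $\langle \mathbf e_1,\mathbf p_2\rangle+\langle \mathbf e_2,\mathbf p_1\rangle=0$; thus $\dim T^*V_{n,2}=4n-6$. The standard contact form is $\alpha=-\sum_i e_2^i\,de_1^i|_{V_{n,2}}$. **Twisted symplectic form.** $\omega_\eta$ is the restriction to $T^*V_{n,2}$ of $\sum_i \big(dp_1^i\wedge de_1^i+dp_2^i\wedge de_2^i\big)+\eta\sum_i de_1^i\wedge de_2^i$, i.e. the canonical form plus $\eta$ times the pull-back of $d\alpha$. The sign convention is that for $\eta=0$ in $\mathbb R^{4n}$ Hamilton's equations read $\dot{\mathbf e}_i=\partial H/\partial \mathbf p_i$, $\dot{\mathbf p}_i=-\partial H/\partial \mathbf e_i$. $\{\cdot,\cdot\}_\eta$ is the Poisson bracket of $\omega_\eta$. **Momentum mapping.** For $x,y\in\mathbb R^n$ (columns), $x\wedge y=xy^T-yx^T\in so(n)$;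 $\langle A,B\rangle=-\frac12\operatorname{tr}(AB)$ on $so(n)$; $\mathbf E_1,\dots,\mathbf E_n$ is the standard basis of $\mathbb R^n$. $\Phi_\eta=\mathbf p_1\wedge \mathbf e_1+\mathbf p_2\wedge \mathbf e_2+\eta\,\mathbf e_1\wedge \mathbf e_2$ is the momentum mapping of the left $SO(n)$-action $(\mathbf e_i,\mathbf p_i)\mapsto(R\mathbf e_i,R\mathbf p_i)$ on $(T^*V_{n,2},\omega_\eta)$. Also $\Psi=\langle \mathbf e_1,\mathbf p_2\rangle-\langle \mathbf e_2,\mathbf p_1\rangle$. **Metrics.** For $a=(a_1,a_2,a_3,a_4)\in\mathbb R^4$, $$H_a=\tfrac12 a_1\langle \mathbf p_1,\mathbf p_1\rangle+\tfrac12 a_2\langle \mathbf p_2,\mathbf p_2\rangle+a_3\langle \mathbf p_1,\mathbf e_2\rangle\langle \mathbf p_2,\mathbf e_1\rangle+a_4\langle \mathbf p_1,\mathbf p_2\rangle .$$ For $n=3$ and $b=(b_1,\dots,b_6)\in\mathbb R^6$, with $\mathbf e_3=\mathbf e_1\times\mathbf e_2$, $$H_b=\tfrac12 b_1\langle \mathbf p_1,\mathbf e_3\rangle^2+\tfrac12 b_2\langle \mathbf p_2,\mathbf e_3\rangle^2+\tfrac12 b_3\Psi^2+b_4\langle \mathbf p_1,\mathbf e_3\rangle\langle \mathbf p_2,\mathbf e_3\rangle+b_5\Psi\langle \mathbf p_1,\mathbf e_3\rangle+b_6\Psi\langle \mathbf p_2,\mathbf e_3\rangle .$$ The parameters are assumed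 such that $H_a$ (resp. $H_b$) is positive definite in the momenta on the fibres of $T^*V_{n,2}$, and $ds_a^2$ (resp. $ds_b^2$) is the Riemannian metric on $V_{n,2}$ whose geodesic Hamiltonian is $H_a$ (resp. $H_b$). **Non-commutative integrability.** An algebra $\mathcal F$ of functions (closed under the Poisson bracket) on a symplectic manifold $M$ is complete if at a generic point $x$, with $F_x=\operatorname{span}\{df(x): f\in\mathcal F\}$, one has $\dim F_x+\dim\ker(\{\cdot,\cdot\}|_{F_x})=\dim M$. A Hamiltonian system is completely integrable in the non-commutative sense if it possesses a complete algebra $\mathcal F$ of first integrals. The regular compact connected common level sets of $\mathcal F$ are then isotropic invariant tori of dimension $\dim M-\dim F_x$; this is the ''dimension of invariant isotropic manifolds/tori''.
   Formalization: When η=0 and H is a multiple of ⟨Φ,Φ⟩ (a=(c,c,−c,0), resp. b=(c,c,c,0,0,0)), the algebra generated by the Φ^{ij} and H is not complete; there only the existence of some complete algebra of first integrals, with the same torus dimension, is asserted. *)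

(* Defs.v *)
From HB Require Import structures.
From mathcomp Require Import all_boot all_order all_algebra.
From mathcomp Require Import all_classical all_reals all_analysis.
Set Implicit Arguments.
Unset Strict Implicit.
Unset Printing Implicit Defensive.
Import Order.TTheory GRing.Theory Num.Theory numFieldNormedType.Exports.
Local Open Scope classical_set_scope.
Local Open Scope ring_scope.

(* Functions on T^*V_{n,2} are represented by smooth functions on the ambient
   space R^{4n}; only their values on T^*V_{n,2} and their differentials along
   its tangent spaces are ever used. *)

Definition span_of (R : realType) (vT : vectType R) (S : set vT) :
    {vspace vT} :=
  xget 0%VS [set W : {vspace vT} | (forall v, S v -> v \in W) /\
    forall W' : {vspace vT}, (forall v, S v -> v \in W') -> (W <= W')%VS].

Lemma span_ofP (R : realType) (vT : vectType R) (S : set vT) :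
  (forall v, S v -> v \in span_of S) /\
  forall W : {vspace vT}, (forall v, S v -> v \in W) -> (span_of S <= W)%VS.
Proof.
suff [W HW] : exists W : {vspace vT}, (forall v, S v -> v \in W) /\
    forall W' : {vspace vT}, (forall v, S v -> v \in W') -> (W <= W')%VS.
  by rewrite /span_of; case: xgetP => [_ _ //|/(_ W)].
pose P k := `[< exists W : {vspace vT}, \dim W = k /\
  forall W' : {vspace vT}, (forall v, S v -> v \in W') -> (W <= W')%VS >].
have P0 : exists k, P k.
  by exists 0%N; apply/asboolP; exists 0%VS; split=> [|W' _];
    rewrite ?dimv0 ?sub0v.
have Pub k : P k -> (k <= \dim {:vT})%N.
  by move=> /asboolP[W [<- _]]; rewrite dimvS ?subvf.
case: (ex_maxnP P0 Pub) => k /asboolP[W [dW minW]] maxk.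
exists W; split=> // v Sv; apply/negPn/negP => vW.
suff : (\dim (W + <[v]>) <= k)%N.
  rewrite -dW => le_dim; move/negP: vW; apply.
  have /eqP eqW : W == (W + <[v]>)%VS by rewrite eqEdim addvSl.
  by rewrite eqW memvE addvSr.
apply/maxk/asboolP; exists (W + <[v]>)%VS; split=> // W' SW'.
by rewrite subv_add minW //= -memvE SW'.
Qed.

Definition dot (R : realType) (n : nat) (u v : 'cV[R]_n) : R :=
  \sum_i u i 0 * v i 0.

Definition wedge (R : realType) (n : nat) (u v : 'cV[R]_n) : 'M[R]_n :=
  u *m v^T - v *m u^T.

Definition so_ip (R : realType) (n : nat) (A B : 'M[R]_n) : R :=
  - 2^-1 * \tr (A *m B).

Definition stdbasis (R : realType) (n : nat) (i : 'I_n) : 'cV[R]_n :=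
  delta_mx i 0.

(* The indices are added in 'I_3, i.e. modulo 3. *)
Definition cross (R : realType) (u v : 'cV[R]_3) : 'cV[R]_3 :=
  \col_(i < 3) (u (i + 1) 0 * v (i + 2) 0 - u (i + 2) 0 * v (i + 1) 0).

(* R^{4n}: the four columns of x are e_1, e_2, p_1, p_2. *)
Notation ambient R n := ('M[R]_(n, 4)).

Definition e1 (R : realType) (n : nat) (x : ambient R n) : 'cV[R]_n := col 0 x.
Definition e2 (R : realType) (n : nat) (x : ambient R n) : 'cV[R]_n := col 1 x.
Definition p1 (R : realType) (n : nat) (x : ambient R n) : 'cV[R]_n := col 2 x.
Definition p2 (R : realType) (n : nat) (x : ambient R n) : 'cV[R]_n := col 3 x.

Definition constraints (R : realType) (n : nat) : seq (ambient R n -> R) :=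
  [:: fun x => dot (e1 x) (e1 x) - 1;
      fun x => dot (e2 x) (e2 x) - 1;
      fun x => dot (e1 x) (e2 x);
      fun x => dot (e1 x) (p1 x);
      fun x => dot (e2 x) (p2 x);
      fun x => dot (e1 x) (p2 x) + dot (e2 x) (p1 x)].

Definition TstarV (R : realType) (n : nat) : set (ambient R n) :=
  [set x | all (fun c => c x == 0) (constraints R n)].

(* 0 is a regular value of the constraints, so the tangent space is the
   common kernel of their differentials. *)
Definition tangent (R : realType) (n : nat) (x : ambient R n) :
    {vspace ambient R n} :=
  (\bigcap_(c <- constraints R n) lker (linfun ('d c x)))%VS.

Definition tvec (R : realType) (n : nat) (x : ambient R n) :=
  subvs_of (tangent x).

Definition covec (R : realType) (n : nat) (x : ambient R n) :=
  'Hom(tvec x, R^o).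

Definition dM (R : realType) (n : nat) (f : ambient R n -> R)
    (x : ambient R n) : covec x :=
  linfun (fun v : tvec x => 'd f x (vsval v) : R^o).

Fixpoint Ck (R : realType) (n : nat) (k : nat) (f : ambient R n -> R) : Prop :=
  match k with
  | 0 => continuous f
  | k'.+1 => (forall x, differentiable f x) /\
             forall v, Ck k' (fun x => 'D_v f x)
  end.

Definition smooth (R : realType) (n : nat) (f : ambient R n -> R) : Prop :=
  forall k, Ck k f.

(* "At a generic point of T^*V": on a relatively open dense subset. *)
Definition generically (R : realType) (n : nat) (P : ambient R n -> Prop) :
    Prop :=
  exists U : set (ambient R n),
    [/\ open U, TstarV (R := R) (n := n) `<=` closure (U `&` TstarV (n := n))
      & forall x, U x -> TstarV x -> P x].

Definition omega (R : realType) (n : nat) (eta : R) (u v : ambient R n) : R :=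
  (dot (p1 u) (e1 v) - dot (e1 u) (p1 v))
  + (dot (p2 u) (e2 v) - dot (e2 u) (p2 v))
  + eta * (dot (e1 u) (e2 v) - dot (e2 u) (e1 v)).

(* X |-> omega_eta (-, X).  With this sign, omega_eta (-, X_H) = dH gives
   e' = dH/dp, p' = - dH/de on R^{4n} when eta = 0. *)
Definition flat (R : realType) (n : nat) (eta : R) (x : ambient R n) :
    'Hom(tvec x, covec x) :=
  linfun (fun X : tvec x =>
    linfun (fun v : tvec x => omega eta (vsval v) (vsval X) : R^o)).

(* omega_eta is nondegenerate on the tangent spaces of T^*V, where the total
   inverse of linear maps is therefore the genuine one. *)
Definition sharp (R : realType) (n : nat) (eta : R) (x : ambient R n) :
    'Hom(covec x, tvec x) := (flat eta x)^-1%VF.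

Definition hamvec (R : realType) (n : nat) (eta : R) (f : ambient R n -> R)
    (x : ambient R n) : tvec x := sharp eta x (dM f x).

Definition cobracket (R : realType) (n : nat) (eta : R) (x : ambient R n)
    (a b : covec x) : R := a (sharp eta x b).

(* {f, g} = df (X_g) *)
Definition bracket (R : realType) (n : nat) (eta : R)
    (f g : ambient R n -> R) (x : ambient R n) : R :=
  cobracket eta (dM f x) (dM g x).

Definition function_algebra (R : realType) (n : nat)
    (F : set (ambient R n -> R)) : Prop :=
  [/\ forall c : R, F (fun=> c),
      forall f g, F f -> F g -> F (fun x => f x + g x)
    & forall f g, F f -> F g -> F (fun x => f x * g x)].

Definition poisson_closed (R : realType) (n : nat) (eta : R)
    (F : set (ambient R n -> R)) : Prop :=
  forall f g, F f -> F g ->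
    exists2 h, F h & forall x, TstarV x -> h x = bracket eta f g x.

Definition dspan (R : realType) (n : nat) (F : set (ambient R n -> R))
    (x : ambient R n) : {vspace covec x} :=
  span_of [set dM f x | f in F].

Definition dspan_ker (R : realType) (n : nat) (eta : R)
    (F : set (ambient R n -> R)) (x : ambient R n) : {vspace covec x} :=
  span_of [set a | a \in dspan F x /\
                   forall b, b \in dspan F x -> cobracket eta a b = 0].

Definition complete_algebra (R : realType) (n : nat) (eta : R)
    (F : set (ambient R n -> R)) : Prop :=
  [/\ function_algebra F, forall f, F f -> smooth f, poisson_closed eta F
    & generically (fun x =>
        (\dim (dspan F x) + \dim (dspan_ker eta F x))%N = \dim (tangent x))].

Definition trajectory (R : realType) (n : nat) (eta : R)
    (H : ambient R n -> R) (a b : R) (g : R -> ambient R n) : Prop :=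
  forall t : R, a < t < b ->
    TstarV (g t) /\ is_derive t (1 : R) g (vsval (hamvec eta H (g t))).

Definition first_integral (R : realType) (n : nat) (eta : R)
    (H f : ambient R n -> R) : Prop :=
  forall (a b : R) (g : R -> ambient R n), trajectory eta H a b g ->
  forall s t : R, a < s < b -> a < t < b -> f (g s) = f (g t).

Definition complete_integrals (R : realType) (n : nat) (eta : R)
    (H : ambient R n -> R) (F : set (ambient R n -> R)) : Prop :=
  complete_algebra eta F /\ forall f, F f -> first_integral eta H f.

(* The regular compact connected common level sets of a complete algebra of
   first integrals are isotropic tori of dimension dim M - dim F_x. *)
Definition isotropic_dim (R : realType) (n : nat)
    (F : set (ambient R n -> R)) (d : nat) : Prop :=
  generically (fun x => (\dim (tangent x) - \dim (dspan F x))%N = d).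

Definition Phi (R : realType) (n : nat) (eta : R) (x : ambient R n) : 'M[R]_n :=
  wedge (p1 x) (e1 x) + wedge (p2 x) (e2 x) + eta *: wedge (e1 x) (e2 x).

Definition Phi_comp (R : realType) (n : nat) (eta : R) (i j : 'I_n)
    (x : ambient R n) : R :=
  so_ip (Phi eta x) (wedge (stdbasis R i) (stdbasis R j)).

Definition Psi (R : realType) (n : nat) (x : ambient R n) : R :=
  dot (e1 x) (p2 x) - dot (e2 x) (p1 x).

Definition momentum_algebra (R : realType) (n : nat) (eta : R)
    (H : ambient R n -> R) : set (ambient R n -> R) :=
  smallest (@function_algebra R n)
    ([set Phi_comp eta ij.1 ij.2 | ij in [set ij : 'I_n * 'I_n | (ij.1 < ij.2)%N]]
     `|` [set H]).

Definition Ha (R : realType) (n : nat) (a1 a2 a3 a4 : R) (x : ambient R n) : R :=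
  2^-1 * a1 * dot (p1 x) (p1 x) + 2^-1 * a2 * dot (p2 x) (p2 x)
  + a3 * (dot (p1 x) (e2 x) * dot (p2 x) (e1 x))
  + a4 * dot (p1 x) (p2 x).

Definition Hb (R : realType) (b1 b2 b3 b4 b5 b6 : R) (x : ambient R 3) : R :=
  let e3 := cross (e1 x) (e2 x) in
  2^-1 * b1 * dot (p1 x) e3 ^+ 2 + 2^-1 * b2 * dot (p2 x) e3 ^+ 2
  + 2^-1 * b3 * Psi x ^+ 2
  + b4 * (dot (p1 x) e3 * dot (p2 x) e3)
  + b5 * (Psi x * dot (p1 x) e3) + b6 * (Psi x * dot (p2 x) e3).

Definition fibre_posdef (R : realType) (n : nat) (H : ambient R n -> R) : Prop :=
  forall x, TstarV x -> ~ (p1 x = 0 /\ p2 x = 0) -> 0 < H x.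

(* Main.v *)
(* Write x = [e1 e2 p1 p2] and let J be the antisymmetric 4 x 4 matrix for which
   omega_eta (v, w) = sum_ab J_ab <v_a, w_b>; then Phi_eta = x J x^T, and the
   Hamiltonian vector field of Phi_ij is x |-> (E_i ^ E_j) x.  Hence an
   SO(n)-invariant K commutes with Phi, and the differentials of the algebra F
   generated by Phi and K span the annihilator of
     S_x = {v tangent : dPhi v = 0, dK v = 0}.
   By symplectic duality F is complete at x as soon as omega vanishes on S_x, and
   the codimension of the span of the differentials is then dim S_x.

   If n >= 4 and e1, e2, p1, p2 are independent, {v tangent : dPhi v = 0} is
   parametrized explicitly by R^4 (by R^3, in the frame e1, e2, e1 x e2, if
   n = 3).  On this space omega has rank 2 and omega ^ dK = 0, so that omega
   vanishes on the kernel S_x of dK if dK does not vanish on this space, and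
   then dim S_x = 3 (dim S_x = 2 if n = 3).  The coefficients of dK are
   polynomials which vanish identically only in the exceptional case, where the
   Hamiltonian is a multiple of <Phi, Phi>; there K = Psi is used instead.
   Genericity follows since the fibres of T^*V are vector spaces and a nonzero
   polynomial on a line has finitely many roots. *)
From HB Require Import structures.
Require Import Defs.
From mathcomp Require Import all_boot all_order all_algebra.
From mathcomp Require Import all_classical all_reals all_analysis.
From mathcomp Require Import ring lra.
Import Order.TTheory GRing.Theory Num.Theory numFieldNormedType.Exports.
Set Implicit Arguments.
Unset Strict Implicit.
Unset Printing Implicit Defensive.
Local Open Scope classical_set_scope.
Local Open Scope ring_scope.

(** * Annihilators and polarity *)

Section Annihilators.
Variables (K : fieldType) (V : vectType K).
Implicit Types (U : {vspace V}) (a b : 'Hom(V, K^o)) (S : seq 'Hom(V, K^o)).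

Definition annv S : {vspace V} := (\bigcap_(b <- S) lker b)%VS.

Lemma memv_annv S v : reflect (forall b, b \in S -> b v = 0) (v \in annv S).
Proof.
rewrite /annv; elim: S => [|b S IHs]; first by rewrite big_nil memvf; constructor.
rewrite big_cons memv_cap memv_ker; apply: (iffP andP).
  by move=> [/eqP bv /IHs sv] c; rewrite inE => /orP[/eqP ->|/sv].
move=> sv; split; first by apply/eqP/sv; rewrite mem_head.
by apply/IHs => c cs; apply: sv; rewrite inE cs orbT.
Qed.

(** The statement is relative to a subspace [U] so that the induction on [S] can pass from [U] to
    the part of [U] killed by the first form. *)
Lemma double_annv_in U S a :
  (forall v, v \in U -> v \in annv S -> a v = 0) ->
  exists2 b, b \in <<S>>%VS & forall v, v \in U -> a v = b v.
Proof.
elim: S U => [|b S IHs] U aUs.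
  by exists 0 => [|v vU]; rewrite ?mem0v // lfunE aUs // /annv big_nil memvf.
have [v vU sv|b' b'S b'P] := IHs (U :&: lker b)%VS.
  move: vU; rewrite memv_cap memv_ker => /andP[vU bv]; apply: aUs => //.
  by rewrite /annv big_cons memv_cap memv_ker bv.
have [[u uU bu0]|bU] := pselect (exists2 u, u \in U & b u != 0); last first.
  exists b'; first by rewrite span_cons memvE (subv_trans _ (addvSr _ _)) -?memvE.
  move=> v vU; apply: b'P; rewrite memv_cap vU memv_ker.
  by apply/negPn/negP => bv; apply: bU; exists v.
(* The coefficient makes the combination agree with [a] at [u]. Any [v] in [U] differs from a
   multiple of [u] by an element of [lker b], where [b'] already agrees with [a]. *)
exists (b' + ((a u - b' u) / b u) *: b).
  rewrite span_cons addrC memv_add //; exact/memvZ/memv_line.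
move=> v vU; have : v - (b v / b u) *: u \in (U :&: lker b)%VS.
  rewrite memv_cap memvB ?memvZ //= memv_ker linearB linearZ /=.
  by rewrite /GRing.scale /= divfK // subrr.
move/b'P; rewrite !linearB !linearZ /= !lfunE /= lfunE /= /GRing.scale /=.
move=> abv; have -> : a v = b' v + b v / b u * - b' u - b v / b u * - a u.
  by rewrite -abv addrK.
by ring.
Qed.

Lemma double_annv S a : (forall v, v \in annv S -> a v = 0) -> a \in <<S>>%VS.
Proof.
move=> asv; have [v _|b bS ab] := @double_annv_in fullv S a; first exact: asv.
by rewrite (_ : a = b) //; apply/lfunP => v; rewrite ab ?memvf.
Qed.

(** A form independent of [S] cannot vanish on [annv S], by the double annihilator, so each new form
    lowers the dimension by exactly one. *)
Lemma dimv_annv S : free S -> (\dim (annv S) + size S = \dim {:V})%N.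
Proof.
elim: S => [|b S IHs]; first by rewrite /annv big_nil addn0.
rewrite free_cons => /andP[bs /IHs <-]; rewrite /annv big_cons -/(annv S).
have im1 : \dim (b @: annv S) = 1%N.
  apply/eqP; rewrite eqn_leq (leq_trans (dimvS (subvf _))) ?dimvf //=.
  rewrite lt0n dimv_eq0; apply: contra bs => /eqP bS0.
  apply: double_annv => v Sv; apply/eqP; rewrite -memv0 -bS0; exact: memv_img.
by rewrite capvC -(limg_ker_dim b (annv S)) im1 addn1 addSnnS.
Qed.

End Annihilators.

(** * Polarity with respect to a nondegenerate skew form *)

Section Polarity.
Variables (K : fieldType) (V : vectType K).
Variables (f : 'Hom(V, 'Hom(V, K^o))) (W : {vspace 'Hom(V, K^o)}).
Hypothesis f_skew : forall v w, f v w = - f w v.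
Hypothesis f_inj : lker f == 0%VS.

Lemma memv_ann_basis v :
  reflect (forall a, a \in W -> a v = 0) (v \in annv (vbasis W)).
Proof.
apply: (iffP (memv_annv _ _)) => Wv a aW; last exact/Wv/vbasis_mem.
rewrite (coord_vbasis aW) sum_lfunE big1 // => i _.
by rewrite scale_lfunE Wv ?scaler0 // mem_nth // size_tuple.
Qed.

Lemma dim_ann_basis : (\dim (annv (vbasis W)) + \dim W = \dim {:V})%N.
Proof.
by rewrite -(dimv_annv (basis_free (vbasisP W))) size_tuple.
Qed.

(** An injective map from [V] to its dual is onto by equality of dimensions, so the total inverse is
    also a right inverse. *)
Lemma lker0_dual_lfunVK : cancel f^-1%VF f.
Proof.
move=> b; apply: limg_lfunVK.
suff -> : limg f = fullv by rewrite memvf.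
apply/eqP; rewrite eqEdim subvf limg_dim_eq ?(eqP f_inj) ?capv0 //.
by rewrite !dimvf /dim /= muln1.
Qed.

(** Let A be the annihilator of [W]. If A is isotropic, a form [f v] with [v] in A kills A and hence
    lies in [W] by the double annihilator; skewness turns the pairing of [f v] with [b] into
    [- b v], which is zero. The same identity read backwards gives the converse: [f] maps A onto the
    kernel of the bracket on [W]. *)
Lemma memv_isotropic_polar :
  (forall v w, v \in annv (vbasis W) -> w \in annv (vbasis W) -> f v w = 0) ->
  forall a, a \in (f @: annv (vbasis W))%VS <->
    a \in W /\ forall b, b \in W -> a (f^-1%VF b) = 0.
Proof.
move=> iso a; split=> [/memv_imgP[v vS ->]|[aW aP]].
  split=> [|b bW].
    rewrite -(span_basis (vbasisP W)); apply: double_annv => w wS; exact: iso.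
  rewrite f_skew lker0_dual_lfunVK.
  by rewrite (memv_ann_basis _ vS) // oppr0.
rewrite -[a]lker0_dual_lfunVK; apply/memv_img/memv_ann_basis => b bW.
by rewrite -[b]lker0_dual_lfunVK f_skew lker0_dual_lfunVK aP // oppr0.
Qed.

Lemma dim_isotropic_polar :
  (forall v w, v \in annv (vbasis W) -> w \in annv (vbasis W) -> f v w = 0) ->
  (\dim W + \dim (f @: annv (vbasis W)) = \dim {:V})%N.
Proof.
move=> iso; rewrite limg_dim_eq ?(eqP f_inj) ?capv0 // addnC; exact: dim_ann_basis.
Qed.

End Polarity.

(** * Images of hyperplanes under a linear parametrization *)

Section Hyperplane.
Variables (K : fieldType) (U V : vectType K).
Variables (phi : 'Hom(U, V)) (l : 'Hom(V, K^o)).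

Lemma memv_image_hyperplane v :
  v \in (phi @: lker (l \o phi))%VS <-> (exists u, v = phi u) /\ l v = 0.
Proof.
split=> [/memv_imgP[u]|[[u ->] lu]].
  by rewrite memv_ker comp_lfunE => /eqP lu ->; split=> //; exists u.
by apply: memv_img; rewrite memv_ker comp_lfunE lu.
Qed.

Lemma dim_image_hyperplane u0 : lker phi == 0%VS -> l (phi u0) != 0 ->
  \dim (phi @: lker (l \o phi)) = (dim U).-1.
Proof.
move=> inj_phi lu0.
rewrite limg_dim_eq ?(eqP inj_phi) ?capv0 // -dimvf.
rewrite -(limg_ker_dim (l \o phi) fullv) capfv.
suff -> : \dim (limg (l \o phi)) = 1%N by rewrite addn1.
apply/eqP; rewrite eqn_leq (leq_trans (dimvS (subvf _))) ?dimvf //=.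
rewrite lt0n dimv_eq0; apply: contra lu0 => /eqP im0.
by rewrite -comp_lfunE -memv0 -im0 memv_img ?memvf.
Qed.

End Hyperplane.

Lemma linfunE (K : fieldType) (U V : vectType K) (f : U -> V) :
  linear f -> linfun f =1 f.
Proof.
move=> lf; pose L : {linear U -> V} := HB.pack f (GRing.isLinear.Build _ _ _ _ f lf).
exact: (lfunE L).
Qed.

Lemma span_of_vspace (R : realType) (vT : vectType R) (W : {vspace vT}) :
  span_of [set v | v \in W] = W.
Proof.
have [sub minW] := span_ofP (R := R) [set v | v \in W].
by apply/eqP; rewrite eqEsubv minW //=; apply/subvP.
Qed.

(** * Polynomial functions on the phase space *)

Section Polynomial_functions.
Variables (R : realType) (n : nat).
Implicit Types (f g : ambient R n -> R) (x v : ambient R n).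

Lemma function_algebra_smallest (G : set (ambient R n -> R)) :
  function_algebra (smallest (@function_algebra R n) G).
Proof.
split=> [c A [[Ac _ _] _]|f g Ff Fg A AG|f g Ff Fg A AG]; first exact: Ac.
  by have [[_ AD _] _] := AG; exact: (AD f g (Ff _ AG) (Fg _ AG)).
by have [[_ _ AM] _] := AG; exact: (AM f g (Ff _ AG) (Fg _ AG)).
Qed.

(** Generating the polynomials as a function algebra gives them the same induction as the momentum
    algebra: a property closed under sums and products need only be checked on constants and
    coordinates. *)
Definition polynomial_fun : set (ambient R n -> R) :=
  smallest (@function_algebra R n)
    [set (fun x : ambient R n => x ij.1 ij.2) | ij in [set: 'I_n * 'I_4]].

Lemma function_algebra_polynomial : function_algebra polynomial_fun.
Proof. exact: function_algebra_smallest. Qed.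

Lemma polynomial_cst c : polynomial_fun (fun=> c).
Proof. by have [Pc _ _] := function_algebra_polynomial; exact: Pc. Qed.

Lemma polynomialD f g : polynomial_fun f -> polynomial_fun g ->
  polynomial_fun (fun x => f x + g x).
Proof. by have [_ PD _] := function_algebra_polynomial; exact: PD. Qed.

Lemma polynomialM f g : polynomial_fun f -> polynomial_fun g ->
  polynomial_fun (fun x => f x * g x).
Proof. by have [_ _ PM] := function_algebra_polynomial; exact: PM. Qed.

Lemma polynomialN f : polynomial_fun f -> polynomial_fun (fun x => - f x).
Proof.
move=> Pf; rewrite (_ : (fun x => _) = fun x => (- 1) * f x).
  by apply: polynomialM => //; exact: polynomial_cst.
by apply/funext => x; rewrite mulN1r.
Qed.

Lemma polynomialB f g : polynomial_fun f -> polynomial_fun g ->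
  polynomial_fun (fun x => f x - g x).
Proof. by move=> Pf Pg; apply: polynomialD => //; exact: polynomialN. Qed.

Lemma polynomialX f k : polynomial_fun f -> polynomial_fun (fun x => f x ^+ k).
Proof.
move=> Pf; elim: k => [|k IHk]; first exact: polynomial_cst.
rewrite (_ : (fun x => _) = fun x => f x * f x ^+ k); first exact: polynomialM.
by apply/funext => x; rewrite exprS.
Qed.

Lemma polynomial_sum (I : Type) (r : seq I) (F : I -> ambient R n -> R) :
  (forall i, polynomial_fun (F i)) ->
  polynomial_fun (fun x => \sum_(i <- r) F i x).
Proof.
move=> PF; elim: r => [|i r IHr].
  rewrite (_ : (fun x => _) = fun=> 0); first exact: polynomial_cst.
  by apply/funext => x; rewrite big_nil.
rewrite (_ : (fun x => _) = fun x => F i x + \sum_(j <- r) F j x).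
  exact: polynomialD.
by apply/funext => x; rewrite big_cons.
Qed.

Lemma polynomial_coord i j : polynomial_fun (fun x => x i j).
Proof. by move=> A [_]; apply; exists (i, j). Qed.

Lemma polynomial_dot (a b : 'I_4) : polynomial_fun (fun x => dot (col a x) (col b x)).
Proof.
apply: polynomial_sum => i; apply: polynomialM.
  by under eq_fun do rewrite mxE; exact: polynomial_coord.
by under eq_fun do rewrite mxE; exact: polynomial_coord.
Qed.

(** The value of ['d f x] is meaningful only for differentiable [f], so both facts travel together
    through the differentiation rules. *)
Definition has_diff f x v (l : R) := differentiable f x /\ 'd f x v = l.

Lemma has_diff_eq f x v l m : has_diff f x v m -> l = m -> has_diff f x v l.
Proof. by move=> fm ->. Qed.

Lemma has_diff_cst c x v : has_diff (fun=> c) x v 0.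
Proof. by split; [exact: differentiable_cst|rewrite (diff_cst c)]. Qed.

Lemma has_diffD f g x v l m : has_diff f x v l -> has_diff g x v m ->
  has_diff (fun y => f y + g y) x v (l + m).
Proof.
move=> [df <-] [dg <-]; split; first exact: differentiableD.
exact: (congr1 (@^~ v) (diffD df dg)).
Qed.

Lemma has_diffM f g x v l m : has_diff f x v l -> has_diff g x v m ->
  has_diff (fun y => f y * g y) x v (f x * m + g x * l).
Proof.
move=> [df <-] [dg <-]; split; first exact: differentiableM.
exact: (congr1 (@^~ v) (diffM df dg)).
Qed.

Lemma has_diffZ c f x v l : has_diff f x v l ->
  has_diff (fun y => c * f y) x v (c * l).
Proof.
move=> /(has_diffM (has_diff_cst c x v)); by rewrite mulr0 addr0.
Qed.

Lemma has_diffN f x v l : has_diff f x v l -> has_diff (fun y => - f y) x v (- l).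
Proof.
move=> /(has_diffZ (-1)); rewrite mulN1r.
by under eq_fun do rewrite mulN1r.
Qed.

Lemma has_diff_sum (I : Type) (r : seq I) (F : I -> ambient R n -> R) l x v :
  (forall i, has_diff (F i) x v (l i)) ->
  has_diff (fun y => \sum_(i <- r) F i y) x v (\sum_(i <- r) l i).
Proof.
move=> dF; elim: r => [|i r IHr].
  rewrite big_nil (_ : (fun y => _) = fun=> 0); first exact: has_diff_cst.
  by apply/funext => y; rewrite big_nil.
rewrite big_cons (_ : (fun y => _) = fun y => F i y + \sum_(j <- r) F j y).
  exact: has_diffD.
by apply/funext => y; rewrite big_cons.
Qed.

Lemma has_diff_coord i j x v : has_diff (fun y => y i j) x v (v i j).
Proof.
split; first exact: differentiable_coord.
have @L : {linear ambient R n -> R}.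
  by exists (fun y : ambient R n => y i j); do 2![eexists]; do ?[constructor];
     rewrite ?mxE// => ? *; rewrite ?mxE//; move=> ?; rewrite !mxE.
by rewrite (diff_lin (f := L)) //; exact: coord_continuous.
Qed.

Lemma has_diff_dot (a b : 'I_4) x v :
  has_diff (fun y => dot (col a y) (col b y)) x v
           (dot (col a v) (col b x) + dot (col a x) (col b v)).
Proof.
rewrite (_ : _ + _ = \sum_i (x i a * v i b + x i b * v i a)); last first.
  rewrite addrC -big_split; apply: eq_bigr => i _.
  by rewrite !mxE [v i a * _]mulrC.
rewrite (_ : (fun y => _) = fun y : ambient R n => \sum_i (y i a * y i b)).
  apply: has_diff_sum => i; exact/has_diffM/has_diff_coord/has_diff_coord.
by apply/funext => y; apply: eq_bigr => i _; rewrite !mxE.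
Qed.

(** The induction also carries polynomiality of [f] itself, since the product rule multiplies each
    derivative by the other factor. *)
Lemma polynomial_derive f : polynomial_fun f ->
  (forall x, differentiable f x) /\
  forall v, polynomial_fun (fun x => 'd f x v).
Proof.
suff sub : polynomial_fun `<=` [set f | [/\ polynomial_fun f,
    forall x, differentiable f x & forall v, polynomial_fun (fun x => 'd f x v)]].
  by move=> /sub[].
apply: smallest_sub => [|_ [[i j] _ <-]]; last first.
  split=> [|x|v]; [exact: polynomial_coord|by case: (has_diff_coord i j x 0)|].
  rewrite (_ : (fun x => _) = fun=> v i j); first exact: polynomial_cst.
  by apply/funext => x; case: (has_diff_coord i j x v).
split=> [c|g h [Pg dg Pdg] [Ph dh Pdh]|g h [Pg dg Pdg] [Ph dh Pdh]].
- split=> [|x|v]; [exact: polynomial_cst|by case: (has_diff_cst c x 0)|].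
  rewrite (_ : (fun x => _) = fun=> 0); first exact: polynomial_cst.
  by apply/funext => x; case: (has_diff_cst c x v).
- have ghP x v : has_diff (fun y => g y + h y) x v ('d g x v + 'd h x v).
    exact: has_diffD.
  split=> [|x|v]; [exact: polynomialD|by case: (ghP x 0)|].
  by rewrite (funext (fun x => (ghP x v).2)); exact: polynomialD (Pdg v) (Pdh v).
- have ghP x v : has_diff (fun y => g y * h y) x v (g x * 'd h x v + h x * 'd g x v).
    exact: has_diffM.
  split=> [|x|v]; [exact: polynomialM|by case: (ghP x 0)|].
  rewrite (funext (fun x => (ghP x v).2)).
  exact: polynomialD (polynomialM Pg (Pdh v)) (polynomialM Ph (Pdg v)).
Qed.

Lemma polynomial_differentiable f x : polynomial_fun f -> differentiable f x.
Proof. by case/polynomial_derive. Qed.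

Lemma polynomial_continuous f : polynomial_fun f -> continuous f.
Proof.
by move=> Pf x; apply: differentiable_continuous; exact: polynomial_differentiable.
Qed.

Lemma polynomial_smooth f : polynomial_fun f -> smooth f.
Proof.
move=> + k; elim: k f => [|k IHk] f Pf /=; first exact: polynomial_continuous.
have [df Pdf] := polynomial_derive Pf; split=> // v; apply: IHk.
rewrite (_ : (fun x => _) = fun x => 'd f x v) //.
by apply/funext => x; rewrite deriveE.
Qed.

Lemma polynomial_line f x v : polynomial_fun f ->
  exists p : {poly R}, forall t, f (x + t *: v) = p.[t].
Proof.
suff sub : polynomial_fun `<=` [set f |
    exists p : {poly R}, forall t, f (x + t *: v) = p.[t]] by move=> /sub.
apply: smallest_sub => [|_ [[i j] _ <-]]; last first.
  by exists ((x i j)%:P + v i j *: 'X) => t; rewrite !hornerE !mxE mulrC.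
split=> [c|g h [p gp] [q hq]|g h [p gp] [q hq]].
- by exists c%:P => t; rewrite hornerC.
- by exists (p + q) => t; rewrite hornerD gp hq.
- by exists (p * q) => t; rewrite hornerM gp hq.
Qed.

(** On the line, [f] is a one-variable polynomial that is nonzero at 1. It cannot vanish at [size p]
    distinct parameters, and that many can be chosen arbitrarily close to 0. *)
Lemma polynomial_line_neq0 f x v (B : set (ambient R n)) : polynomial_fun f ->
  f (x + v) != 0 -> nbhs x B -> exists t : R, B (x + t *: v) /\ f (x + t *: v) != 0.
Proof.
move=> Pf fxv Bx; have [p fp] := polynomial_line x v Pf.
have p0 : p != 0.
  by apply: contra fxv => /eqP p0; rewrite -[v]scale1r fp p0 horner0.
have cont : (fun t : R => x + t *: v) @ (0 : R) --> x + 0 *: v.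
  by apply: cvgD; [exact: cvg_cst|apply: cvgZr_tmp; exact: cvg_id].
rewrite scale0r addr0 in cont.
have /nbhs_ballP[e /= e0 Be] := cont _ Bx.
apply: contrapT => noroot.
(* Dividing by k + 2 rather than k + 1 keeps every parameter strictly inside the ball, including k =
   0. *)
have eB k : ball (0 : R) e (e / k.+2%:R).
  rewrite /ball /= sub0r normrN gtr0_norm ?divr_gt0 // ltr_pdivrMr //.
  by rewrite ltr_pMr // ltr1n.
pose s := [seq e / k.+2%:R | k <- iota 0 (size p)].
have rs : all (root p) s.
  apply/allP => _ /mapP[k _ ->]; apply/negPn/negP => pk; apply: noroot.
  by exists (e / k.+2%:R); split; [exact/Be/eB|rewrite fp].
have us : uniq s.
  rewrite map_inj_in_uniq ?iota_uniq // => i j _ _ /(mulfI (lt0r_neq0 e0)).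
  by move=> /invr_inj /eqP; rewrite eqr_nat => /eqP[].
by have := max_poly_roots p0 rs us; rewrite size_map size_iota ltnn.
Qed.

Lemma zero_derivative_constant (h : R -> R) (a b : R) :
  (forall t, a < t < b -> is_derive t 1 h 0) ->
  forall s t, a < s < b -> a < t < b -> h s = h t.
Proof.
move=> h' s t; wlog lest : s t / s <= t => [wl sab tab|].
  by have [/wl|/ltW/wl] := leP s t => // ->.
move=> /andP[as_ sb] /andP[at_ tb].
have h'st u : u \in `[s, t] -> is_derive u 1 h 0.
  rewrite in_itv /= => /andP[su ut]; apply: h'.
  by rewrite (lt_le_trans as_ su) (le_lt_trans ut tb).
have cont : {within `[s, t], continuous h}.
  by apply: derivable_within_continuous => u /h'st[].
have h'st_oo (u : R) : u \in `]s, t[ -> is_derive u 1 h ((fun=> 0) u).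
  by move=> ust; apply: h'st; exact: subset_itv_oo_cc.
have [u _] := MVT_segment lest h'st_oo cont.
by rewrite mul0r => /eqP; rewrite subr_eq0 => /eqP.
Qed.

Lemma is_derive_along f (g : R -> ambient R n) (t : R) w :
  differentiable f (g t) -> is_derive t 1 g w ->
  is_derive t 1 (f \o g) ('d f (g t) w).
Proof.
move=> df [dg <-]; have dg' : differentiable g t by apply/derivable1_diffP.
have dfg : differentiable (f \o g) t by exact: differentiable_comp.
apply: DeriveDef; first exact: diff_derivable.
by rewrite (deriveE _ dfg) diff_comp //= (deriveE _ dg').
Qed.

End Polynomial_functions.

(** * The momentum map and the twisted form *)

Section Dot.
Variables (R : realType) (n : nat).
Implicit Types (u v w : 'cV[R]_n).

Lemma dotC u v : dot u v = dot v u.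
Proof. by apply: eq_bigr => i _; rewrite mulrC. Qed.

Lemma dotDl u v w : dot (u + v) w = dot u w + dot v w.
Proof. by rewrite -big_split; apply: eq_bigr => i _; rewrite mxE mulrDl. Qed.

Lemma dotZl c u v : dot (c *: u) v = c * dot u v.
Proof. by rewrite mulr_sumr; apply: eq_bigr => i _; rewrite mxE mulrA. Qed.

Lemma dotDr u v w : dot u (v + w) = dot u v + dot u w.
Proof. by rewrite dotC dotDl ![dot _ u]dotC. Qed.

Lemma dotZr c u v : dot u (c *: v) = c * dot u v.
Proof. by rewrite dotC dotZl dotC. Qed.

Lemma dotNl u v : dot (- u) v = - dot u v.
Proof. by rewrite -scaleN1r dotZl mulN1r. Qed.

Lemma dotNr u v : dot u (- v) = - dot u v.
Proof. by rewrite dotC dotNl dotC. Qed.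

Lemma dot0l v : dot 0 v = 0.
Proof. by rewrite -(scale0r v) dotZl mul0r. Qed.

Lemma dot_ge0 u : 0 <= dot u u.
Proof. by apply: sumr_ge0 => i _; rewrite -expr2 sqr_ge0. Qed.

Lemma dot_eq0 u : dot u u = 0 -> u = 0.
Proof.
move/eqP; rewrite psumr_eq0 => [/allP u0|i _]; last by rewrite -expr2 sqr_ge0.
apply/colP => i; have := u0 i; rewrite mem_index_enum -expr2 sqrf_eq0 mxE.
by move=> /(_ isT)/eqP.
Qed.

Lemma dot_trmx u v : u^T *m v = (dot u v)%:M.
Proof.
apply/matrixP => i j; rewrite !ord1 !mxE /=; apply: eq_bigr => k _.
by rewrite mxE.
Qed.

Lemma dot_stdbasis (i : 'I_n) u : dot (stdbasis R i) u = u i 0.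
Proof.
rewrite /dot (bigD1 i) //= big1 => [|k ki]; rewrite !mxE ?eqxx ?mul1r ?addr0 //.
by rewrite (negPf ki) mul0r.
Qed.

Lemma wedgeDef u v : wedge u v = u *m v^T - v *m u^T.
Proof. by []. Qed.

End Dot.

Lemma dot3 (R : realType) (u v : 'cV[R]_3) :
  dot u v = u 0 0 * v 0 0 + u 1 0 * v 1 0 + u 2 0 * v 2 0.
Proof.
rewrite /dot !big_ord_recl big_ord0 addr0 addrA.
by congr (_ + u _ _ * v _ _ + u _ _ * v _ _); apply: val_inj.
Qed.

Local Opaque dot wedge.

(** * Tangent spaces, the momentum map and the infinitesimal action *)

Section Phase_space.
Variables (R : realType) (n : nat) (eta : R).
Implicit Types (x v w X : ambient R n) (f g h : ambient R n -> R).

Lemma TstarVP x : TstarV x <->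
  [/\ dot (e1 x) (e1 x) = 1, dot (e2 x) (e2 x) = 1 & dot (e1 x) (e2 x) = 0] /\
  [/\ dot (e1 x) (p1 x) = 0, dot (e2 x) (p2 x) = 0
    & dot (e1 x) (p2 x) + dot (e2 x) (p1 x) = 0].
Proof.
rewrite /TstarV /= !subr_eq0 andbT; split.
  by move=> /and5P[/eqP-> /eqP-> /eqP-> /eqP-> /andP[/eqP-> /eqP->]].
by move=> [[-> -> ->] [-> -> ->]]; rewrite !eqxx.
Qed.

Lemma memv_capker (s : seq (ambient R n -> R)) x v :
  (v \in \bigcap_(c <- s) lker (linfun ('d c x)))%VS = all (fun c => 'd c x v == 0) s.
Proof.
elim: s => [|c s IHs]; first by rewrite big_nil memvf.
by rewrite big_cons memv_cap IHs memv_ker lfunE.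
Qed.

Lemma tangentP x v : v \in tangent x <->
  [/\ dot (e1 x) (e1 v) = 0, dot (e2 x) (e2 v) = 0
    & dot (e1 x) (e2 v) + dot (e2 x) (e1 v) = 0] /\
  [/\ dot (e1 v) (p1 x) + dot (e1 x) (p1 v) = 0,
      dot (e2 v) (p2 x) + dot (e2 x) (p2 v) = 0
    & dot (e1 v) (p2 x) + dot (e1 x) (p2 v)
      + (dot (e2 v) (p1 x) + dot (e2 x) (p1 v)) = 0].
Proof.
have D (a b : 'I_4) := has_diff_dot a b x v.
have DB (a b : 'I_4) : has_diff (fun y => dot (col a y) (col b y) - 1) x v
    (dot (col a v) (col b x) + dot (col a x) (col b v)).
  by rewrite -[X in has_diff _ _ _ X]addr0; apply/has_diffD/has_diff_cst/D.
have DD (a b c d : 'I_4) := has_diffD (D a b) (D c d).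
have c1 : 'd (fun y => dot (e1 y) (e1 y) - 1) x v = _ := (DB 0 0).2.
have c2 : 'd (fun y => dot (e2 y) (e2 y) - 1) x v = _ := (DB 1 1).2.
have c3 : 'd (fun y => dot (e1 y) (e2 y)) x v = _ := (D 0 1).2.
have c4 : 'd (fun y => dot (e1 y) (p1 y)) x v = _ := (D 0 2%R).2.
have c5 : 'd (fun y => dot (e2 y) (p2 y)) x v = _ := (D 1 3%R).2.
have c6 : 'd (fun y => dot (e1 y) (p2 y) + dot (e2 y) (p1 y)) x v = _ := (DD 0 3%R 1 2%R).2.
(* The two unit-length constraints are quadratic in a single column, so their differentials carry a
   factor 2. *)
have dbl (a : R) : (a + a == 0) = (a == 0) by rewrite -mulr2n mulrn_eq0.
rewrite /tangent memv_capker -(all_map (fun c => 'd c x v) (pred1 0)).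
have -> : [seq 'd c x v | c <- constraints R n] = _ :=
 (f_equal2 cons c1 (f_equal2 cons c2 (f_equal2 cons c3 (f_equal2 cons c4
  (f_equal2 cons c5 (f_equal2 cons c6 (erefl [::]))))))).

rewrite /all /pred1 /= [dot (col 0 v) (col 0 x)]dotC [dot (col 1 v) (col 1 x)]dotC.
rewrite [dot (col 0 v) (col 1 x)]dotC [in X in [&& _, _, X & _]]addrC !dbl andbT.
split=> [/and5P[/eqP-> /eqP-> /eqP E3 /eqP E4 /andP[/eqP E5 /eqP E6]]//|].
by move=> [[E1 E2 E3] [E4 E5 E6]]; apply/and5P; split; last (apply/andP; split);
  apply/eqP.
Qed.

Definition dPhi x v : 'M[R]_n :=
  wedge (p1 v) (e1 x) + wedge (p1 x) (e1 v)
  + (wedge (p2 v) (e2 x) + wedge (p2 x) (e2 v))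
  + eta *: (wedge (e1 v) (e2 x) + wedge (e1 x) (e2 v)).

Lemma Phi_entryE x i j : Phi eta x i j =
  x i 2 * x j 0 - x i 0 * x j 2 + (x i 3 * x j 1 - x i 1 * x j 3)
  + eta * (x i 0 * x j 1 - x i 1 * x j 0).
Proof. by rewrite !mxE !big_ord1 !mxE. Qed.

Lemma dPhi_entryE x v i j : dPhi x v i j =
  v i 2 * x j 0 - x i 0 * v j 2 + (x i 2 * v j 0 - v i 0 * x j 2)
  + (v i 3 * x j 1 - x i 1 * v j 3 + (x i 3 * v j 1 - v i 1 * x j 3))
  + eta * (v i 0 * x j 1 - x i 1 * v j 0 + (x i 0 * v j 1 - v i 1 * x j 0)).
Proof. by rewrite !mxE !big_ord1 !mxE. Qed.

Lemma Phi_compE (i j : 'I_n) x : Phi_comp eta i j x = Phi eta x i j.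
Proof.
have tr (k l : 'I_n) : \tr (Phi eta x *m (stdbasis R k *m (stdbasis R l)^T)) = Phi eta x l k.
  rewrite mulmxA mxtrace_mulC trmx_delta -rowE /mxtrace big_ord1 mxE.
  by rewrite -colE mxE.
rewrite /Phi_comp /so_ip wedgeDef mulmxBr raddfB /= !tr.
by rewrite !Phi_entryE; field.
Qed.

Lemma polynomial_Phi i j : polynomial_fun (Phi_comp (n := n) eta i j).
Proof.
rewrite (funext (Phi_compE i j)) (funext (fun x => Phi_entryE x i j)).
have X (k : 'I_n) (a : 'I_4) := @polynomial_coord R n k a.
by do ?[apply: polynomialB|apply: polynomialD|apply: polynomialM|exact: X
       |exact: polynomial_cst].
Qed.

Lemma has_diff_Phi i j x v :
  has_diff (Phi_comp (n := n) eta i j) x v (dPhi x v i j).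
Proof.
rewrite (funext (Phi_compE i j)) (funext (fun x => Phi_entryE x i j)).
have X (k l : 'I_n) (a b : 'I_4) :=
  has_diffM (has_diff_coord k a x v) (has_diff_coord l b x v).
have B (k l k' l' : 'I_n) (a b a' b' : 'I_4) :=
  has_diffD (X k l a b) (has_diffN (X k' l' a' b')).
rewrite dPhi_entryE; apply: has_diff_eq.
  apply: has_diffD (has_diffD (B i j i j 2 0 0 2) (B i j i j 3 1 1 3)) _.
  exact: has_diffZ (B i j i j 0 1 1 0).
by ring.
Qed.

Definition so_act (i j : 'I_n) x : ambient R n := wedge (stdbasis R i) (stdbasis R j) *m x.

Lemma col_so_act i j x a : col a (so_act i j x) = x j a *: stdbasis R i - x i a *: stdbasis R j.
Proof.
rewrite /so_act wedgeDef mulmxBl -!mulmxA !trmx_delta -!rowE.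
by apply/colP => k; rewrite !mxE !big_ord1 !mxE mulrC [x i a * _]mulrC.
Qed.

Lemma dot_so_actr u i j x a : dot u (col a (so_act i j x)) = u i 0 * x j a - u j 0 * x i a.
Proof.
by rewrite col_so_act dotDr dotNr !dotZr ![dot u _]dotC !dot_stdbasis; ring.
Qed.

Lemma dot_so_actl u i j x a : dot (col a (so_act i j x)) u = u i 0 * x j a - u j 0 * x i a.
Proof. by rewrite dotC dot_so_actr. Qed.

(** This is the momentum map equation. It holds on all of R^{4n}, and restricts to T^*V because the
    action is tangent there. *)
Lemma omega_so_act i j x v : omega eta v (so_act i j x) = dPhi x v i j.
Proof.
by rewrite dPhi_entryE /omega /e1 /e2 /p1 /p2 !dot_so_actr !mxE; ring.
Qed.

Lemma tangent_so_act i j x : so_act i j x \in tangent x.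
Proof.
apply/tangentP.
rewrite /e1 /e2 /p1 /p2 !dot_so_actr !dot_so_actl !mxE.
by do ?split; ring.
Qed.

Lemma omega_skew v w : omega eta v w = - omega eta w v.
Proof.
rewrite /omega (dotC (p1 v)) (dotC (p2 v)) (dotC (e1 v) (p1 w)) (dotC (e2 v) (p2 w)).
by rewrite (dotC (e1 v)) (dotC (e2 v)); ring.
Qed.

End Phase_space.

(** * Assembling phase-space vectors from columns *)

Section Ambient_columns.
Variables (R : realType) (n : nat).
Implicit Types (u v : 'cV[R]_n) (x : ambient R n).

Definition of_cols u1 u2 u3 u4 : ambient R n :=
  \matrix_(i, j) (nth 0 [:: u1; u2; u3; u4] j) i 0.

Lemma e1_of_cols u1 u2 u3 u4 : e1 (of_cols u1 u2 u3 u4) = u1.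
Proof. by apply/colP => i; rewrite !mxE. Qed.

Lemma e2_of_cols u1 u2 u3 u4 : e2 (of_cols u1 u2 u3 u4) = u2.
Proof. by apply/colP => i; rewrite !mxE. Qed.

Lemma p1_of_cols u1 u2 u3 u4 : p1 (of_cols u1 u2 u3 u4) = u3.
Proof. by apply/colP => i; rewrite !mxE. Qed.

Lemma p2_of_cols u1 u2 u3 u4 : p2 (of_cols u1 u2 u3 u4) = u4.
Proof. by apply/colP => i; rewrite !mxE. Qed.

Definition of_colsE := (e1_of_cols, e2_of_cols, p1_of_cols, p2_of_cols).

Lemma of_cols_eta x : x = of_cols (e1 x) (e2 x) (p1 x) (p2 x).
Proof.
apply/matrixP => i j; rewrite mxE.
case: j => [[|[|[|[|//]]]] jlt] /=; rewrite mxE; congr (x i _); exact: val_inj.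
Qed.

Lemma eq_cols x y : e1 x = e1 y -> e2 x = e2 y -> p1 x = p1 y -> p2 x = p2 y -> x = y.
Proof. by rewrite [x]of_cols_eta [y]of_cols_eta !of_colsE => -> -> -> ->. Qed.

Lemma matrix_linE (p q : nat) c (A B : 'M[R]_(p, q)) i j : (c *: A + B) i j = c * A i j + B i j.
Proof. by rewrite !mxE. Qed.

Lemma e1_lin c x y : e1 (c *: x + y) = c *: e1 x + e1 y. Proof. exact: linearP. Qed.
Lemma e2_lin c x y : e2 (c *: x + y) = c *: e2 x + e2 y. Proof. exact: linearP. Qed.
Lemma p1_lin c x y : p1 (c *: x + y) = c *: p1 x + p1 y. Proof. exact: linearP. Qed.
Lemma p2_lin c x y : p2 (c *: x + y) = c *: p2 x + p2 y. Proof. exact: linearP. Qed.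

End Ambient_columns.

(** * Nondegeneracy of the twisted form and Hamiltonian vector fields *)

Section Twisted_form.
Variables (R : realType) (n : nat) (eta : R).
Implicit Types (x v w : ambient R n) (f g h : ambient R n -> R).

Lemma omega_linear_l w : linear (fun v => omega eta v w : R^o).
Proof.
move=> c u v; rewrite /omega !e1_lin !e2_lin !p1_lin !p2_lin !dotDl !dotZl.
by rewrite /GRing.scale /=; ring.
Qed.

Lemma dME f x (v : tvec x) : dM f x v = 'd f x (vsval v).
Proof.
apply: (linfunE (f := fun v : tvec x => 'd f x (vsval v) : R^o)) => c u w.
by rewrite !linearP.
Qed.

Lemma flatE x (X v : tvec x) : flat eta x X v = omega eta (vsval v) (vsval X).
Proof.
have lin (Y : tvec x) : linear (fun v : tvec x => omega eta (vsval v) (vsval Y) : R^o).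
  by move=> c u w; rewrite linearP /=; exact: omega_linear_l.
rewrite /flat (linfunE (f := fun X : tvec x => linfun _)) ?linfunE // => c Y Z.
apply/lfunP => w; rewrite add_lfunE scale_lfunE !linfunE //.
rewrite [LHS]omega_skew linearP /= [LHS](congr1 -%R (omega_linear_l _ _ _ _)).
rewrite opprD -scalerN -!omega_skew //.
Qed.

Lemma flat_skew x (X v : tvec x) : flat eta x X v = - flat eta x v X.
Proof. by rewrite !flatE omega_skew. Qed.

(* Nondegeneracy: if omega(-, X) = 0 then pairing with the vertical vector
   (0, 0, de1, de2) gives de1 = de2 = 0, and then pairing with a tangent vector
   over (dp1, dp2) gives dp1 = dp2 = 0. *)
Lemma lker_flat x : TstarV x -> lker (flat eta x) == 0%VS.
Proof.
move=> /TstarVP[[e11 e22 e12] [ep11 ep22 ep12]].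
rewrite -subv0; apply/subvP => X; rewrite memv_ker memv0 => /eqP flatX.
have orth v : v \in tangent x -> omega eta v (vsval X) = 0.
  by move=> vT; rewrite -(vsprojK vT) -flatE flatX lfunE.
have /tangentP[[t1 t2 t3] [t4 t5 t6]] := subvsP X.
have add0 (a b : R) : 0 <= a -> 0 <= b -> a + b = 0 -> a = 0 /\ b = 0.
  by move=> a0 b0 ab; split; lra.
have [de1 de2] : e1 (vsval X) = 0 /\ e2 (vsval X) = 0.
  have /orth : of_cols 0 0 (e1 (vsval X)) (e2 (vsval X)) \in tangent x.
    apply/tangentP; rewrite !of_colsE !(dotC _ 0) !dot0l !add0r.
    by split; split=> //; rewrite [LHS]addrC.
  rewrite /omega !of_colsE !dot0l => H.
  have [|/dot_eq0-> /dot_eq0-> //] :=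
    add0 _ _ (dot_ge0 (e1 (vsval X))) (dot_ge0 (e2 (vsval X))).
  by lra.
move: t4 t5 t6; rewrite de1 de2 !dot0l !add0r => t4 t5 t6.
have [dp1 dp2] : p1 (vsval X) = 0 /\ p2 (vsval X) = 0.
  set q1 := p1 (vsval X); set q2 := p2 (vsval X).
  (* The corrections along [e1 x] and [e2 x] restore tangency: [c] occurs twice in the mixed
     constraint, hence the division by 2. They do not affect the pairing, as the [e1] and [e2] parts
     of [X] are already zero. *)
  pose c := - (dot q1 (p2 x) + dot q2 (p1 x)) / 2.
  have /orth : of_cols q1 q2 (- dot q1 (p1 x) *: e1 x + c *: e2 x)
                 (- dot q2 (p2 x) *: e2 x + c *: e1 x) \in tangent x.
    apply/tangentP; rewrite !of_colsE !dotDr !dotZr (dotC (e2 x) (e1 x)) e11 e22 e12.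
    by rewrite t4 t5 t6 /c; split; split=> //; field.
  rewrite /omega !of_colsE de1 de2 !(dotC _ 0) !dot0l => H.
  have [|/dot_eq0-> /dot_eq0-> //] := add0 _ _ (dot_ge0 q1) (dot_ge0 q2).
  by lra.
apply/eqP/val_inj => /=; apply: eq_cols; rewrite ?de1 ?de2 ?dp1 ?dp2.
all: by apply/colP => i; rewrite !mxE.
Qed.

Lemma flatK x : TstarV x -> cancel (flat eta x) (sharp eta x).
Proof. by move=> xM; apply: lker0_lfunK; exact: lker_flat. Qed.

Lemma flat_hamvec f x : TstarV x -> flat eta x (hamvec eta f x) = dM f x.
Proof. by move=> xM; apply: lker0_dual_lfunVK; exact: lker_flat. Qed.

Lemma bracketE f g x : bracket eta f g x = 'd f x (vsval (hamvec eta g x)).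
Proof. by rewrite -dME. Qed.

Lemma bracket_skew f g x : TstarV x -> bracket eta f g x = - bracket eta g f x.
Proof.
move=> xM; have E h k : bracket eta h k x = flat eta x (hamvec eta h x) (hamvec eta k x).
  by rewrite (flat_hamvec h xM).
by rewrite !E; exact: flat_skew.
Qed.

Lemma hamvec_Phi i j x : TstarV x -> vsval (hamvec eta (Phi_comp eta i j) x) = so_act i j x.
Proof.
move=> xM; rewrite /hamvec; have -> : dM (Phi_comp eta i j) x =
    flat eta x (vsproj (tangent x) (so_act i j x)).
  apply/lfunP => v; rewrite dME flatE vsprojK ?tangent_so_act //.
  by rewrite omega_so_act (has_diff_Phi eta i j x (vsval v)).2.
by rewrite flatK // vsprojK // tangent_so_act.
Qed.

End Twisted_form.

(** * The algebra generated by the momentum map and an invariant *)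

Section Momentum_algebra.
Variables (R : realType) (n : nat) (eta : R) (K : ambient R n -> R).
Hypothesis polyK : polynomial_fun K.
Implicit Types (x v w : ambient R n) (f g h : ambient R n -> R).

Let F := momentum_algebra eta K.

(** Invariance is infinitesimal and is asked only on T^*V, where the constraints simplify the
    differentials of the Hamiltonians. *)
Definition so_invariant f :=
  forall x i j, TstarV x -> 'd f x (so_act i j x) = 0.

Lemma momentum_algebra_closed : function_algebra F.
Proof. exact: function_algebra_smallest. Qed.

Lemma momentum_algebra_K : F K.
Proof. by move=> A [_]; apply; right. Qed.

Lemma momentum_algebra_cst c : F (fun=> c).
Proof. by have [Fc _ _] := momentum_algebra_closed; exact: Fc. Qed.

Lemma momentum_algebraZ c f : F f -> F (fun x => c * f x).
Proof.
have [Fc _ FM] := momentum_algebra_closed => Ff; exact: FM (Fc c) Ff.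
Qed.

Lemma momentum_algebra_Phi i j : F (Phi_comp eta i j).
Proof.
wlog ij : i j / (i <= j)%N => [wl|].
  have [/wl//|/ltnW/wl Fji] := leqP i j.
  rewrite (_ : Phi_comp eta i j = fun x => -1 * Phi_comp eta j i x).
    exact: momentum_algebraZ.
  by apply/funext => x; rewrite !Phi_compE !Phi_entryE; ring.
move: ij; rewrite leq_eqVlt => /orP[/eqP/val_inj->|ij]; last first.
  by move=> A [_]; apply; left; exists (i, j).
rewrite (_ : Phi_comp eta j j = fun=> 0); first exact: momentum_algebra_cst.
by apply/funext => x; rewrite !Phi_compE !Phi_entryE; ring.
Qed.

(** Membership in [F] is kept in the sum and product cases, because the rules for differentials need
    differentiability of both arguments. *)
Lemma momentum_algebra_ind (P : (ambient R n -> R) -> Prop) :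
  (forall c, P (fun=> c)) ->
  (forall f g, F f -> F g -> P f -> P g -> P (fun x => f x + g x)) ->
  (forall f g, F f -> F g -> P f -> P g -> P (fun x => f x * g x)) ->
  (forall i j, P (Phi_comp eta i j)) -> P K ->
  forall f, F f -> P f.
Proof.
move=> Pc PD PM PPhi PK f Ff.
have [Fc FD FM] := momentum_algebra_closed.
suff sub : F `<=` [set f | F f /\ P f] by case: (sub _ Ff).
apply: smallest_sub => [|g [[[i j] _ <-]|->]]; last 2 first.
- by split; [exact: momentum_algebra_Phi|exact: PPhi].
- by split; [exact: momentum_algebra_K|].
split=> [c|g h [Fg Pg] [Fh Ph]|g h [Fg Pg] [Fh Ph]].
- by split; [exact: Fc|exact: Pc].
- by split; [exact: FD|exact: PD].
- by split; [exact: FM|exact: PM].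
Qed.

Lemma momentum_algebra_polynomial f : F f -> polynomial_fun f.
Proof.
move: f; apply: momentum_algebra_ind => //.
- exact: polynomial_cst.
- by move=> f g _ _; exact: polynomialD.
- by move=> f g _ _; exact: polynomialM.
- exact: polynomial_Phi.
Qed.

Lemma momentum_algebra_diff f x v : F f -> has_diff f x v ('d f x v).
Proof.
by move=> /momentum_algebra_polynomial Pf; split=> //; exact: polynomial_differentiable.
Qed.

(** The witness is given by the commutation relations of so(n). *)
Lemma bracket_Phi_Phi i j k l : exists2 h, F h &
  forall x, TstarV x -> h x = bracket eta (Phi_comp eta i j) (Phi_comp eta k l) x.
Proof.
have [_ FD _] := momentum_algebra_closed.
exists (fun x => (i == k)%:R * Phi_comp eta l j x + - (i == l)%:R * Phi_comp eta k j x
     + ((j == k)%:R * Phi_comp eta i l x + - (j == l)%:R * Phi_comp eta i k x)).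
  by apply: (FD); apply: (FD); apply: momentum_algebraZ; exact: momentum_algebra_Phi.
move=> x xM; rewrite bracketE hamvec_Phi // (has_diff_Phi eta i j x _).2.
have actE (m : 'I_n) (a : 'I_4) :
    so_act k l x m a = (m == k)%:R * x l a - (m == l)%:R * x k a.
  transitivity (col a (so_act k l x) m 0); first by rewrite [RHS]mxE.
  by rewrite col_so_act !mxE /= ?eqxx ?andbT; ring.
by rewrite !Phi_compE !Phi_entryE dPhi_entryE !actE; ring.
Qed.

Lemma bracket_invariant_Phi f i j x : so_invariant f -> TstarV x ->
  bracket eta f (Phi_comp eta i j) x = 0.
Proof. by move=> invf xM; rewrite bracketE hamvec_Phi // invf. Qed.

(** The bracket is a derivation in its first argument, so closure under bracketing with [g] need
    only be checked on generators. *)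
Lemma bracket_ind g : F g ->
  (forall i j, exists2 h, F h &
     forall x, TstarV x -> h x = bracket eta (Phi_comp eta i j) g x) ->
  (exists2 h, F h & forall x, TstarV x -> h x = bracket eta K g x) ->
  forall f, F f -> exists2 h, F h & forall x, TstarV x -> h x = bracket eta f g x.
Proof.
move=> Fg gPhi gK; have [Fc FD FM] := momentum_algebra_closed.
apply: (momentum_algebra_ind (P := fun f => exists2 h, F h &
    forall x, TstarV x -> h x = bracket eta f g x)) =>
  [c|f1 f2 F1 F2 [h1 Fh1 h1P] [h2 Fh2 h2P]|f1 f2 F1 F2 [h1 Fh1 h1P] [h2 Fh2 h2P]||];
  last exact: gK; last exact: gPhi.
- exists (fun=> 0) => // x _; rewrite bracketE.
  by rewrite (has_diff_cst c x _).2.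
- exists (fun x => h1 x + h2 x) => [|x xM]; first exact: FD.
  rewrite h1P // h2P // !bracketE; apply/esym.
  by apply: (has_diffD _ _).2; exact: momentum_algebra_diff.
- exists (fun x => f1 x * h2 x + f2 x * h1 x) => [|x xM].
    by apply: FD; exact: FM.
  rewrite h1P // h2P // !bracketE; apply/esym.
  by apply: (has_diffM _ _).2; exact: momentum_algebra_diff.
Qed.

(** The derivation argument is applied with second argument a momentum component, then [K], then any
    element of [F]; skew-symmetry turns the first two results into the hypotheses of the third. *)
Lemma momentum_algebra_poisson : so_invariant K -> poisson_closed eta F.
Proof.
move=> invK; have [Fc _ _] := momentum_algebra_closed.
have sym f g : (exists2 h, F h & forall x, TstarV x -> h x = bracket eta f g x) ->
    exists2 h, F h & forall x, TstarV x -> h x = bracket eta g f x.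
  move=> [h Fh hP]; exists (fun x => -1 * h x) => [|x xM]; first exact: momentum_algebraZ.
  by rewrite bracket_skew // hP // mulN1r.
have zero_inv f i j : so_invariant f -> exists2 h, F h &
    forall x, TstarV x -> h x = bracket eta f (Phi_comp eta i j) x.
  move=> invf; exists (fun=> 0) => // x xM; by rewrite bracket_invariant_Phi.
have PhiF i j f : F f -> exists2 h, F h &
    forall x, TstarV x -> h x = bracket eta f (Phi_comp eta i j) x.
  move: f; apply: bracket_ind; first exact: momentum_algebra_Phi.
    by move=> k l; exact: bracket_Phi_Phi.
  exact: zero_inv.
have KF f : F f -> exists2 h, F h & forall x, TstarV x -> h x = bracket eta f K x.
  move: f; apply: bracket_ind; first exact: momentum_algebra_K.
    by move=> i j; apply/sym/zero_inv.
  exists (fun=> 0) => // x xM.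
  by move: (bracket eta K K x) (bracket_skew eta K K xM) => b; lra.
move=> f g Ff Fg; apply: bracket_ind Ff => //.
  by move=> i j; apply/sym/PhiF.
exact/sym/KF.
Qed.

(** Along a trajectory the derivative of [f] is its bracket with [H], and by the Leibniz rule that
    bracket vanishes on [F] once it vanishes on the generators. *)
Lemma momentum_algebra_integrals H : polynomial_fun H -> so_invariant H ->
  (forall x, TstarV x -> bracket eta K H x = 0) ->
  forall f, F f -> first_integral eta H f.
Proof.
move=> polyH invH KH f Ff a b g traj.
have fH x : TstarV x -> bracket eta f H x = 0.
  move=> xM; move: f Ff.
  apply: momentum_algebra_ind => [c|f1 f2 F1 F2 f10 f20|f1 f2 F1 F2 f10 f20|i j|].
  - by rewrite bracketE (has_diff_cst c x _).2.
  - rewrite bracketE.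
    rewrite (has_diffD (momentum_algebra_diff _ _ F1) (momentum_algebra_diff _ _ F2)).2.
    by rewrite -!bracketE f10 f20 addr0.
  - rewrite bracketE.
    rewrite (has_diffM (momentum_algebra_diff _ _ F1) (momentum_algebra_diff _ _ F2)).2.
    by rewrite -!bracketE f10 f20 !mulr0 addr0.
  - by rewrite bracket_skew // bracket_invariant_Phi // oppr0.
  - exact: KH.
apply: zero_derivative_constant => t /traj[gM g't].
have := is_derive_along (polynomial_differentiable (g t)
  (momentum_algebra_polynomial Ff)) g't.
by rewrite -bracketE fH.
Qed.

(* S is the annihilator of the differentials of the functions in F at x. *)
Definition isotropic_polar x (S : {vspace ambient R n}) :=
  [/\ forall v, v \in S <-> [/\ v \in tangent x, dPhi eta x v = 0 & 'd K x v = 0]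
    & forall v w, v \in S -> w \in S -> omega eta v w = 0].

Lemma dspan_annihilator x (v : tvec x) :
  v \in annv (vbasis (dspan F x)) <->
  dPhi eta x (vsval v) = 0 /\ 'd K x (vsval v) = 0.
Proof.
have [dF minF] := span_ofP (R := R) [set dM f x | f in F].
split=> [/memv_ann_basis vF|[vPhi vK]].
  have dF0 f : F f -> 'd f x (vsval v) = 0.
    by move=> Ff; rewrite -dME; apply/vF/dF; exists f.
  split; last exact: dF0 momentum_algebra_K.
  apply/matrixP => i j; rewrite [RHS]mxE -(has_diff_Phi eta i j x (vsval v)).2.
  exact: dF0 (momentum_algebra_Phi i j).
(* Evaluation at [v] is a linear form on covectors; by minimality of the span, its kernel contains
   [dspan F x] as soon as it contains every [dM f x]. *)
have lin : linear (fun a : covec x => a v) by move=> c a b; rewrite !lfunE /= lfunE.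
apply/memv_ann_basis => a aF.
suff : a \in lker (linfun (fun a : covec x => a v)).
  by rewrite memv_ker (linfunE lin) => /eqP.
apply: subvP aF; apply: minF => _ [f Ff <-].
rewrite memv_ker (linfunE lin) dME; apply/eqP; move: f Ff.
apply: momentum_algebra_ind => [c|f1 f2 F1 F2 f10 f20|f1 f2 F1 F2 f10 f20|i j|//].
- by rewrite (has_diff_cst c x _).2.
- rewrite (has_diffD (momentum_algebra_diff _ _ F1) (momentum_algebra_diff _ _ F2)).2.
  by rewrite f10 f20 addr0.
- rewrite (has_diffM (momentum_algebra_diff _ _ F1) (momentum_algebra_diff _ _ F2)).2.
  by rewrite f10 f20 !mulr0 addr0.
- by rewrite (has_diff_Phi eta i j x _).2 vPhi mxE.
Qed.

(** Seen inside the tangent space, [S] is the annihilator A of [dspan F x]. Isotropy of A makes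
    [dspan_ker] the image of A under [flat], so both dimensions follow from that of A. *)
Lemma dim_dspan x S : TstarV x -> isotropic_polar x S ->
  (\dim (dspan F x) + \dim S = \dim (tangent x))%N /\
  (\dim (dspan F x) + \dim (dspan_ker eta F x) = \dim (tangent x))%N.
Proof.
move=> xM [memS isoS]; set W := dspan F x; set A := annv (vbasis W).
have dimV : \dim {: tvec x} = \dim (tangent x) by rewrite dimvf.
have memA (v : tvec x) : (v \in A) = (vsval v \in S).
  apply/idP/idP => [/dspan_annihilator[vPhi vK]|/memS[_ vPhi vK]].
    by apply/memS; split=> //; exact: subvsP.
  exact/dspan_annihilator.
have dimA : \dim A = \dim S.
  have inj : lker (linfun (vsval : tvec x -> _)) == 0%VS.
    by apply/lker0P => u v; rewrite !lfunE; exact: val_inj.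
  rewrite -(limg_dim_eq (f := linfun (vsval : tvec x -> _))) ?(eqP inj) ?capv0 //.
  congr (\dim _); apply/vspaceP => v; apply/memv_imgP/idP => [[u uA ->]|vS].
    by rewrite lfunE /= -memA.
  have [vT _ _] := (memS v).1 vS.
  by exists (vsproj (tangent x) v); rewrite ?memA ?lfunE /= vsprojK.
have isoA (v w : tvec x) : v \in A -> w \in A -> flat eta x v w = 0.
  by rewrite !memA flatE => vS wS; rewrite isoS.
have dimAW : (\dim A + \dim W = \dim (tangent x))%N by rewrite dim_ann_basis.
split; first by rewrite -dimA addnC.
rewrite -[in RHS]dimV -(dim_isotropic_polar (f := flat eta x) (W := W)) ?lker_flat //.
congr (_ + \dim _)%N; rewrite -[RHS]span_of_vspace; congr span_of.
apply/funext => a; apply/propext.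
apply: iff_sym; apply: memv_isotropic_polar => //; [exact: flat_skew|exact: lker_flat].
Qed.

(** The generator [K] is kept distinct from the Hamiltonian [H], so that the exceptional metrics can
    be treated with [K] equal to [Psi]. *)
Lemma momentum_algebra_complete (H : ambient R n -> R) (d : nat) :
  so_invariant K -> polynomial_fun H -> so_invariant H ->
  (forall x, TstarV x -> bracket eta K H x = 0) ->
  generically (fun x => exists2 S, isotropic_polar x S & \dim S = d) ->
  complete_integrals eta H F /\ isotropic_dim F d.
Proof.
move=> invK polyH invH KH [U [oU dU UP]]; split; last first.
  exists U; split=> // x Ux xM; have [S polS <-] := UP x Ux xM.
  by have [<- _] := dim_dspan xM polS; rewrite addKn.
split; last exact: momentum_algebra_integrals.
split; [exact: momentum_algebra_closed| |exact: momentum_algebra_poisson|].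
  by move=> f Ff; apply: polynomial_smooth; exact: momentum_algebra_polynomial.
exists U; split=> // x Ux xM; have [S polS _] := UP x Ux xM.
by have [_ ->] := dim_dspan xM polS.
Qed.

End Momentum_algebra.

(** * Level sets of the momentum map *)

Section Genericity.
Variables (R : realType) (n : nat).
Implicit Types (x z v w : ambient R n).

(** Once [e1] and [e2] are fixed, the remaining constraints are linear in the momenta. *)
Lemma TstarV_fibre_line x z (t : R) : TstarV x -> TstarV z ->
  e1 z = e1 x -> e2 z = e2 x -> TstarV (x + t *: (z - x)).
Proof.
move=> /TstarVP[[A B C] [D E F]] /TstarVP[_ [D' E' F']] z1 z2.
have -> : x + t *: (z - x) = (1 - t) *: x + t *: z.
  by rewrite scalerBr scalerBl scale1r addrA addrAC.
rewrite z1 z2 in D' E' F'.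
have e1E : e1 ((1 - t) *: x + t *: z) = e1 x.
  by rewrite e1_lin [e1 (_ *: _)]linearZ /= -/(e1 z) z1 -scalerDl subrK scale1r.
have e2E : e2 ((1 - t) *: x + t *: z) = e2 x.
  by rewrite e2_lin [e2 (_ *: _)]linearZ /= -/(e2 z) z2 -scalerDl subrK scale1r.
have p1E : p1 ((1 - t) *: x + t *: z) = (1 - t) *: p1 x + t *: p1 z.
  by rewrite p1_lin [p1 (_ *: _)]linearZ.
have p2E : p2 ((1 - t) *: x + t *: z) = (1 - t) *: p2 x + t *: p2 z.
  by rewrite p2_lin [p2 (_ *: _)]linearZ.
apply/TstarVP; rewrite e1E e2E p1E p2E !dotDr !dotZr D E D' E' !mulr0 addr0.
split; split=> //; rewrite addrACA -!mulrDr F F' !mulr0 addr0 //.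
Qed.

(** One point with [P] nonzero in each fibre is enough: on the line joining it to [x], which stays
    in the fibre, [P] is nonzero at points arbitrarily close to [x]. *)
Lemma generically_polynomial (P : ambient R n -> R) (Q : ambient R n -> Prop) :
  polynomial_fun P ->
  (forall x, TstarV x -> exists z, [/\ TstarV z, e1 z = e1 x, e2 z = e2 x & P z != 0]) ->
  (forall x, TstarV x -> P x != 0 -> Q x) -> generically Q.
Proof.
move=> polyP exP PQ; exists (P @^-1` [set y | y != 0]); split=> [|x xM B Bx|x /= Px xM].
- apply: open_comp => [y _|]; last exact: open_neq.
  exact: polynomial_continuous.
- have [z [zM z1 z2 Pz]] := exP x xM.
  have Pz' : P (x + (z - x)) != 0 by rewrite addrC subrK.
  have [t [Bt Pt]] := polynomial_line_neq0 polyP Pz' Bx.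
  by exists (x + t *: (z - x)); split=> //; split=> //; exact: TstarV_fibre_line.
- exact: PQ.
Qed.

Lemma exists_unit_normal k (M : 'M[R]_(k, n)) : (k < n)%N ->
  exists2 r : 'cV[R]_n, M *m r = 0 & dot r r = 1.
Proof.
move=> kn; have : kermx M^T != 0.
  rewrite kermx_eq0 /row_free; apply: contraTneq kn => rk.
  by rewrite -leqNgt -rk rank_leq_col.
move=> /rowV0Pn[r' /sub_kermxP r'M r'0]; set r := r'^T.
have Mr : M *m r = 0 by rewrite -[LHS]trmxK trmx_mul trmxK r'M trmx0.
have r0 : 0 < dot r r.
  rewrite lt0r dot_ge0 andbT; apply: contra r'0 => /eqP/dot_eq0 r0.
  by rewrite -[r']trmxK -/r r0 trmx0.
exists ((Num.sqrt (dot r r))^-1 *: r); first by rewrite -scalemxAr Mr scaler0.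
rewrite dotZl dotZr mulrA -expr2 exprVn sqr_sqrtr ?dot_ge0 // mulVf //.
by rewrite gt_eqF.
Qed.

End Genericity.

(** * The tangent spaces of momentum level sets, for any n *)

Section Level_sets.
Variables (R : realType) (n : nat) (eta : R).
Implicit Types (x z v w : ambient R n).

Definition dPsi x v : R :=
  dot (e1 v) (p2 x) + dot (e1 x) (p2 v) - (dot (e2 v) (p1 x) + dot (e2 x) (p1 v)).

(** On T^*V this is the only free component of the momenta in the plane of e1 and e2, since there
    the product of e1 with p2 is its opposite. *)
Definition u12 x : R := dot (e2 x) (p1 x).
Definition sA x : R := dot (p1 x) (p1 x) - u12 x ^+ 2.
Definition sB x : R := dot (p2 x) (p2 x) - u12 x ^+ 2.
Definition sC x : R := dot (p1 x) (p2 x).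

(** Bundling all sixteen products for rewriting turns identities between invariants into identities
    in [u12], [sA], [sB] and [sC], within reach of [field]. *)
Lemma gramE x : TstarV x ->
  (dot (e1 x) (e1 x) = 1) * (dot (e2 x) (e2 x) = 1) *
  (dot (e1 x) (e2 x) = 0) * (dot (e2 x) (e1 x) = 0) *
  (dot (e1 x) (p1 x) = 0) * (dot (p1 x) (e1 x) = 0) *
  (dot (e2 x) (p2 x) = 0) * (dot (p2 x) (e2 x) = 0) *
  (dot (e2 x) (p1 x) = u12 x) * (dot (p1 x) (e2 x) = u12 x) *
  (dot (e1 x) (p2 x) = - u12 x) * (dot (p2 x) (e1 x) = - u12 x) *
  (dot (p1 x) (p1 x) = sA x + u12 x ^+ 2) * (dot (p2 x) (p2 x) = sB x + u12 x ^+ 2) *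
  (dot (p1 x) (p2 x) = sC x) * (dot (p2 x) (p1 x) = sC x).
Proof.
move=> /TstarVP[[A B C] [D E F]]; have e1p2 : dot (e1 x) (p2 x) = - u12 x.
  by rewrite /u12; lra.
do ![split]; rewrite ?[RHS](dotC _ (e1 x)) //; rewrite 1?dotC //.
all: by rewrite /sA /sB /sC ?subrK // dotC.
Qed.

Definition comb (y0 y1 y2 y3 : R) x : 'cV[R]_n :=
  y0 *: e1 x + y1 *: e2 x + y2 *: p1 x + y3 *: p2 x.

Lemma dot_comb (y0 y1 y2 y3 : R) x (w : 'cV[R]_n) :
  dot w (comb y0 y1 y2 y3 x) =
  y0 * dot w (e1 x) + y1 * dot w (e2 x) + y2 * dot w (p1 x) + y3 * dot w (p2 x).
Proof. by rewrite /comb !dotDr !dotZr. Qed.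

Lemma combE (y0 y1 y2 y3 : R) x i :
  comb y0 y1 y2 y3 x i 0 = y0 * x i 0 + y1 * x i 1 + y2 * x i 2 + y3 * x i 3.
Proof. by rewrite !mxE. Qed.

Lemma eq_comb (y0 y1 y2 y3 z0 z1 z2 z3 : R) x :
  y0 = z0 -> y1 = z1 -> y2 = z2 -> y3 = z3 ->
  comb y0 y1 y2 y3 x = comb z0 z1 z2 z3 x.
Proof. by move=> -> -> -> ->. Qed.

(* With q1 = p1 - u e2, q2 = p2 + u e1 and w = eta - 2 u, the momentum is
   q1 ^ e1 + q2 ^ e2 + w e1 ^ e2 and sA, sB, sC are <q1, q1>, <q2, q2>,
   <q1, q2>; here a, al, mu are the coefficients of
   e2, q1, q2 in de1, and -a, mu, be those of e1, q1, q2 in de2. *)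
Definition level_vec x (a al be mu : R) : ambient R n :=
  let u := u12 x in let w := eta - 2 * u in
  let A := sA x in let B := sB x in let C := sC x in
  let du := - (mu * (B - A) + (al - be) * C) / 2 in
  of_cols
    (comb (mu * u) (a - al * u) al mu x)
    (comb (- a + be * u) (- mu * u) mu be x)
    (comb (- (al * A + mu * C) + (a + w * be) * u + u * (- a + be * u))
          (- (mu * A + be * C) - w * mu * u + du - u * mu * u)
          (w * mu + u * mu) (a + w * be + u * be) x)
    (comb (- (al * C + mu * B) - w * mu * u - du - u * mu * u)
          (- (mu * C + be * B) + (a + w * al) * u - u * (a - al * u))
          (- (a + w * al) - u * al) (- w * mu - u * mu) x).

Lemma level_vec_tangent x a al be mu : TstarV x -> level_vec x a al be mu \in tangent x.
Proof.
move=> xM; have g := gramE xM; apply/tangentP; rewrite !of_colsE.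
rewrite !(dotC (comb _ _ _ _ _)) !dot_comb !g.
by split; split; field.
Qed.

Lemma level_vec_dPhi x a al be mu : dPhi eta x (level_vec x a al be mu) = 0.
Proof.
apply/matrixP => i j; rewrite dPhi_entryE [RHS]mxE.
have E (k : 'I_n) (v : ambient R n) : (v k 0 = e1 v k 0) * (v k 1 = e2 v k 0) *
   (v k 2 = p1 v k 0) * (v k 3 = p2 v k 0) by rewrite !mxE.
rewrite !(E _ (level_vec _ _ _ _ _)) !of_colsE !combE.
by field.
Qed.

Lemma level_vec_omega x a al be mu a' al' be' mu' : TstarV x ->
  omega eta (level_vec x a al be mu) (level_vec x a' al' be' mu') =
  (sB x - sA x) * (a * mu' - a' * mu)
  + sC x * ((a * al' - a' * al) - (a * be' - a' * be))
  - (eta - 2 * u12 x) * (sA x * (al * mu' - al' * mu) + sC x * (al * be' - al' * be)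
      + sB x * (mu * be' - mu' * be)).
Proof.
move=> xM; have g := gramE xM; rewrite /omega !of_colsE.
rewrite !dot_comb !(dotC (comb _ _ _ _ _)) !dot_comb !g.
by field.
Qed.

(** The common shape of the differentials of [Ha] and [Psi] on T^*V: the differential of h1 |p1|^2 /
    2 + h2 |p2|^2 / 2 + h3 <p1, p2> + h4 Psi with the coefficients held constant. *)
Definition inv_diff x (h1 h2 h3 h4 : R) v : R :=
  h1 * dot (p1 x) (p1 v) + h2 * dot (p2 x) (p2 v)
  + h3 * (dot (p1 x) (p2 v) + dot (p2 x) (p1 v)) + h4 * dPsi x v.

Definition level_coef_a x (h1 h2 h3 : R) : R := (h1 - h2) * sC x + h3 * (sB x - sA x).
Definition level_coef_al x (h1 h2 h3 h4 : R) : R :=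
  - (eta - 2 * u12 x) * (h2 * sC x + h3 * sA x) + (h4 - (h1 + h2) / 2 * u12 x) * sC x.
Definition level_coef_be x (h1 h2 h3 h4 : R) : R :=
  (eta - 2 * u12 x) * (h1 * sC x + h3 * sB x) - (h4 - (h1 + h2) / 2 * u12 x) * sC x.
Definition level_coef_mu x (h1 h2 h3 h4 : R) : R :=
  (eta - 2 * u12 x) * (h1 * sA x - h2 * sB x)
  + (h4 - (h1 + h2) / 2 * u12 x) * (sB x - sA x).

Lemma level_vec_inv_diff x h1 h2 h3 h4 a al be mu : TstarV x ->
  inv_diff x h1 h2 h3 h4 (level_vec x a al be mu) =
  a * level_coef_a x h1 h2 h3 + al * level_coef_al x h1 h2 h3 h4
  + be * level_coef_be x h1 h2 h3 h4 + mu * level_coef_mu x h1 h2 h3 h4.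
Proof.
move=> xM; have g := gramE xM; rewrite /inv_diff /dPsi !of_colsE.
rewrite !(dotC (comb _ _ _ _ _)) !dot_comb !g.
by rewrite /level_coef_a /level_coef_al /level_coef_be /level_coef_mu; field.
Qed.

(* omega restricted to the level set has rank 2 and its kernel is annihilated by
   every invariant differential l, i.e. omega ^ l = 0; hence omega vanishes on
   the kernel of l unless l = 0. *)
Lemma level_vec_isotropic x h1 h2 h3 h4 a0 al0 be0 mu0 a al be mu a' al' be' mu' :
  TstarV x ->
  inv_diff x h1 h2 h3 h4 (level_vec x a0 al0 be0 mu0) != 0 ->
  inv_diff x h1 h2 h3 h4 (level_vec x a al be mu) = 0 ->
  inv_diff x h1 h2 h3 h4 (level_vec x a' al' be' mu') = 0 ->
  omega eta (level_vec x a al be mu) (level_vec x a' al' be' mu') = 0.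
Proof.
move=> xM l0 l l'; apply: (mulIf l0); rewrite mul0r.
pose W := omega (n := n) eta.
(* The cyclic sum is omega ^ l evaluated on three level vectors; [l] and [l'] remove its last two
   terms. *)
have cyc : W (level_vec x a al be mu) (level_vec x a' al' be' mu')
    * inv_diff x h1 h2 h3 h4 (level_vec x a0 al0 be0 mu0)
  + W (level_vec x a' al' be' mu') (level_vec x a0 al0 be0 mu0)
    * inv_diff x h1 h2 h3 h4 (level_vec x a al be mu)
  + W (level_vec x a0 al0 be0 mu0) (level_vec x a al be mu)
    * inv_diff x h1 h2 h3 h4 (level_vec x a' al' be' mu') = 0.
  rewrite /W !level_vec_omega // !level_vec_inv_diff //.
  by rewrite /level_coef_a /level_coef_al /level_coef_be /level_coef_mu; field.
by move: cyc; rewrite l l' !mulr0 !addr0.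
Qed.

Lemma sum4 (f : 'I_4 -> R) : \sum_i f i = f 0 + f 1 + f 2 + f 3.
Proof.
rewrite !big_ord_recl big_ord0 addr0 !addrA.
by congr (_ + f _ + f _ + f _); apply: val_inj.
Qed.

(** This is the matrix J with Phi_eta = x J x^T. *)
Definition twist : 'M[R]_4 := \matrix_(i, j)
  (nth [::] [:: [:: 0; eta; -1; 0]; [:: - eta; 0; 0; -1]; [:: 1; 0; 0; 0];
                [:: 0; 1; 0; 0]] i)`_j.

Lemma dPhi_twist x v : dPhi eta x v = v *m twist *m x^T + x *m twist *m v^T.
Proof.
apply/matrixP => i j; rewrite dPhi_entryE [RHS]mxE !mxE !sum4 !mxE !sum4 !mxE /=.
by ring.
Qed.

(** Independence of the columns gives a left inverse of [x]. Then v J x^T + x J v^T = 0 forces v = x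
    Y with Y J + J Y^T = 0, so Y lies in the 10-dimensional symplectic Lie algebra of J. The six
    tangency equations leave four parameters. *)
Lemma tangent_dPhi_level_vec x v : TstarV x -> row_full x ->
  v \in tangent x -> dPhi eta x v = 0 ->
  exists a al be mu, v = level_vec x a al be mu.
Proof.
move=> xM /row_fullP[L Lx] /tangentP tv; rewrite dPhi_twist => vPhi.
have LxT : x^T *m L^T = 1%:M by rewrite -trmx_mul Lx trmx1.
(* The inverse of J, written out. *)
pose T' : 'M[R]_4 := \matrix_(i, j)
  (nth [::] [:: [:: 0; 0; 1; 0]; [:: 0; 0; 0; 1]; [:: -1; 0; 0; eta];
                [:: 0; -1; - eta; 0]] i)`_j.
have TT' : twist *m T' = 1%:M.
  apply/matrixP; case=> [[|[|[|[|//]]]] ilt]; case=> [[|[|[|[|//]]]] jlt];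
  by rewrite !mxE sum4 !mxE /=; ring.
have [Y vY] : exists Y : 'M[R]_4, v = x *m Y.
  exists (- (twist *m v^T *m L^T *m T')).
  have /eqP : v *m twist *m x^T *m L^T *m T' + x *m twist *m v^T *m L^T *m T' = 0.
    by rewrite -!mulmxDl vPhi !mul0mx.
  rewrite -(mulmxA _ x^T) LxT mulmx1 -(mulmxA _ twist) TT' mulmx1 addr_eq0 => /eqP vE.
  by rewrite [LHS]vE mulmxN !mulmxA.
have YT : Y *m twist + twist *m Y^T = 0.
  have : L *m (v *m twist *m x^T + x *m twist *m v^T) *m L^T = 0.
    by rewrite vPhi mulmx0 mul0mx.
  rewrite mulmxDr mulmxDl vY trmx_mul !mulmxA Lx !mul1mx.
  by rewrite -!(mulmxA _ x^T) LxT !mulmx1.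
have colY b : col b v = comb (Y 0 b) (Y 1 b) (Y 2 b) (Y 3 b) x.
  by apply/colP => k; rewrite [LHS]mxE combE vY mxE sum4; ring.
have yt i j : (Y *m twist + twist *m Y^T) i j = 0 by rewrite YT mxE.
have y01 := yt 0 1; have y02 := yt 0 2; have y03 := yt 0 3.
have y12 := yt 1 2; have y13 := yt 1 3; have y23 := yt 2 3.
move: {yt YT} y01 y02 y03 y12 y13 y23; rewrite !mxE !sum4 !mxE /=.
have g := gramE xM; move: tv; rewrite /e1 /e2 /p1 /p2 !colY.
rewrite !(dotC (comb _ _ _ _ _)) !dot_comb.
rewrite -!/(e1 x) -!/(e2 x) -!/(p1 x) -!/(p2 x) !g.
move=> tv y01 y02 y03 y12 y13 y23.
(* In [level_vec], de1 has coefficients [a - al * u], [al], [mu] on e2, p1, p2, and de2 has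
   coefficient [be] on p2; the parameters are read off from the first two columns of [Y]. *)
exists (Y 1 0 + u12 x * Y 2 0), (Y 2 0), (Y 3 1), (Y 3 0).
suff [E0 E1 E2 E3] : [/\ e1 v = e1 (level_vec x (Y 1 0 + u12 x * Y 2 0) (Y 2 0) (Y 3 1) (Y 3 0)),
   e2 v = e2 (level_vec x (Y 1 0 + u12 x * Y 2 0) (Y 2 0) (Y 3 1) (Y 3 0)),
   p1 v = p1 (level_vec x (Y 1 0 + u12 x * Y 2 0) (Y 2 0) (Y 3 1) (Y 3 0)) &
   p2 v = p2 (level_vec x (Y 1 0 + u12 x * Y 2 0) (Y 2 0) (Y 3 1) (Y 3 0))].
  exact: eq_cols.
rewrite !of_colsE /e1 /e2 /p1 /p2 !colY.
move: tv y01 y02 y03 y12 y13 y23; clear.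
move: (u12 x) (sA x) (sB x) (sC x) => u A B C.
move: (Y 0 0) (Y 0 1) (Y 0 2%R) (Y 0 3%R) => y00 y01 y02 y03.
move: (Y 1 0) (Y 1 1) (Y 1 2%R) (Y 1 3%R) => y10 y11 y12 y13.
move: (Y 2%R 0) (Y 2%R 1) (Y 2%R 2%R) (Y 2%R 3%R) => y20 y21 y22 y23.
move: (Y 3%R 0) (Y 3%R 1) (Y 3%R 2%R) (Y 3%R 3%R) => y30 y31 y32 y33.
move=> [[t1 t2 t3] [t4 t5 t6]] s01 s02 s03 s12 s13 s23.
(* The other entries are eliminated one by one, the [s] equations being the symplectic relations and
   the [t] equations tangency. *)
have E : y21 = y30 by lra.
subst y21; have E : y00 = u * y30 by lra.
subst y00; have E : y11 = - u * y30 by lra.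
subst y11; have E : y01 = - (y10 + u * y20) + u * y31 by lra.
subst y01; have E : y22 = (eta - 2 * u) * y30 + u * y30 by lra.
subst y22; have E : y32 = y10 + u * y20 + (eta - 2 * u) * y31 + u * y31 by lra.
subst y32; have E : y23 = - (y10 + u * y20 + (eta - 2 * u) * y20) - u * y20 by lra.
subst y23; have E : y33 = - (eta - 2 * u) * y30 - u * y30 by lra.
subst y33.
have E : y02 = - (y10 * u + y20 * (A + u ^+ 2) + y30 * C)
    + u * (y10 + u * y20 + (eta - 2 * u) * y31 + u * y31).
  by clear -t4; lra.
subst y02; have E : y13 = - (- u * (- (y10 + u * y20) + u * y31) + y30 * C + y31 * (B + u ^+ 2))
     - u * (- (y10 + u * y20 + (eta - 2 * u) * y20) - u * y20).
  by clear -t5; lra.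
subst y13; clear t1 t2 t3 t4 t5 s02 s03 s12 s13 s23.
have E : y03 = y12 - eta * (- u * y30) - eta * (u * y30).
  by clear -s01; lra.
subst y03; have E : y12 = - (y30 * A + y31 * C) - (eta - 2 * u) * y30 * u
    - (y30 * (B - A) + (y20 - y31) * C) / 2 - u * y30 * u.
  by clear -t6; lra.
by subst y12; split; apply: eq_comb; field.
Qed.

End Level_sets.

(** * Isotropic polars when e1, e2, p1, p2 are independent *)

Section Rank_four.
Variables (R : realType) (n : nat) (eta : R).
Implicit Types (x z v w : ambient R n).

(** Pairing with e1 and e2 expresses [y0] and [y1] through [y3] and [y2]; what remains is the Gram
    system of q1 and q2, solved by Cramer's rule. *)
Lemma comb_eq0 x (y0 y1 y2 y3 : R) : TstarV x ->
  sA x * sB x - sC x ^+ 2 != 0 -> comb y0 y1 y2 y3 x = 0 ->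
  [/\ y0 = 0, y1 = 0, y2 = 0 & y3 = 0].
Proof.
move=> xM D0 y0E; have g := gramE xM.
have E (w : 'cV[R]_n) : y0 * dot w (e1 x) + y1 * dot w (e2 x)
    + y2 * dot w (p1 x) + y3 * dot w (p2 x) = 0.
  by rewrite -dot_comb y0E dotC dot0l.
have E1 := E (e1 x); have E2 := E (e2 x); have E3 := E (p1 x); have E4 := E (p2 x).
move: {E} E1 E2 E3 E4; rewrite !g => E1 E2 E3 E4.
have y0u : y0 = u12 x * y3 by lra.
have y1u : y1 = - u12 x * y2 by lra.
have F3 : sA x * y2 + sC x * y3 = 0 by move: E3; rewrite y1u; lra.
have F4 : sC x * y2 + sB x * y3 = 0 by move: E4; rewrite y0u; lra.
have y2_0 : y2 = 0.
  apply: (mulfI D0); rewrite mulr0.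
  transitivity (sB x * (sA x * y2 + sC x * y3) - sC x * (sC x * y2 + sB x * y3)).
    by ring.
  by rewrite F3 F4; ring.
have y3_0 : y3 = 0.
  apply: (mulfI D0); rewrite mulr0.
  transitivity (sA x * (sC x * y2 + sB x * y3) - sC x * (sA x * y2 + sC x * y3)).
    by ring.
  by rewrite F3 F4; ring.
by rewrite y0u y1u y2_0 y3_0 !mulr0.
Qed.

Lemma row_full_gram x : TstarV x -> sA x * sB x - sC x ^+ 2 != 0 -> row_full x.
Proof.
move=> xM D0; rewrite /row_full -mxrank_tr -/(row_free _) -kermx_eq0.
apply/rowV0P => r /sub_kermxP rx.
have /(comb_eq0 xM D0)[r0 r1 r2 r3] : comb (r 0 0) (r 0 1) (r 0 2) (r 0 3) x = 0.
  apply/colP => i; rewrite combE [RHS]mxE.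
  have := congr1 (fun M : 'rV_n => M 0 i) rx; rewrite [X in _ = X -> _]mxE => <-.
  by rewrite [RHS]mxE sum4 !mxE.
apply/rowP => j; rewrite [RHS]mxE.
case: j => [[|[|[|[|//]]]] jlt]; [rewrite -r0|rewrite -r1|rewrite -r2|rewrite -r3];
  congr (r 0 _); exact: val_inj.
Qed.

Definition level_row x (c : 'rV[R]_4) := level_vec eta x (c 0 0) (c 0 1) (c 0 2) (c 0 3).

Lemma level_row_linear x : linear (level_row x).
Proof.
by move=> c s t; rewrite /level_row !mxE; apply: eq_cols;
  rewrite ?(e1_lin, e2_lin, p1_lin, p2_lin) !of_colsE;
  apply/colP => i; rewrite matrix_linE !combE; field.
Qed.

(** The polar is the hyperplane where dK vanishes in the four-parameter space of level vectors. One
    nonzero coefficient of dK makes it proper, and the sum of squares says that the one of [a] or of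
    [al] is nonzero. *)
Lemma rank_four_isotropic_polar (K : ambient R n -> R) x (h1 h2 h3 h4 : R) :
  TstarV x -> sA x * sB x - sC x ^+ 2 != 0 ->
  (forall v, v \in tangent x -> 'd K x v = inv_diff x h1 h2 h3 h4 v) ->
  level_coef_a x h1 h2 h3 ^+ 2 + level_coef_al eta x h1 h2 h3 h4 ^+ 2 != 0 ->
  exists2 S, isotropic_polar eta K x S & \dim S = 3%N.
Proof.
move=> xM D0 dK coef0; have full := row_full_gram xM D0.
have levelT a al be mu : level_vec eta x a al be mu \in tangent x.
  exact: level_vec_tangent.
pose phi : 'Hom('rV[R]_4, ambient R n) := linfun (level_row x).
pose l : 'Hom(ambient R n, R^o) := linfun ('d K x : _ -> R^o).
have phiE c : phi c = level_row x c by rewrite linfunE //; exact: level_row_linear.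
have lE v : l v = 'd K x v by rewrite lfunE.
have memS v : v \in (phi @: lker (l \o phi))%VS <->
    [/\ v \in tangent x, dPhi eta x v = 0 & 'd K x v = 0].
  rewrite memv_image_hyperplane lE; split=> [[[c ->] lv]|[vT vPhi lv]].
    by split=> //; rewrite phiE; [exact: levelT|exact: level_vec_dPhi].
  split=> //; have [a [al [be [mu vE]]]] := tangent_dPhi_level_vec xM full vT vPhi.
  exists (\row_j [:: a; al; be; mu]`_j).
  by rewrite phiE /level_row !mxE.
have [c0 lc0] : exists c0, l (phi c0) != 0.
  have := coef0; rewrite paddr_eq0 ?sqr_ge0 // negb_and !sqrf_eq0.
  move=> /orP[ca|cal]; [exists (delta_mx 0 0)|exists (delta_mx 0 1)];
    rewrite lE phiE /level_row !mxE /= dK // level_vec_inv_diff // !mul0r !mul1r.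
    by rewrite !addr0.
  by rewrite add0r !addr0.
exists (phi @: lker (l \o phi))%VS; last first.
  rewrite (dim_image_hyperplane (u0 := c0)) // ?dim_matrix //.
  apply/lker0P => c c'; rewrite !phiE => cc'.
  have: level_row x (c - c') = 0.
    by rewrite -scaleN1r addrC level_row_linear cc' scaleN1r addNr.
  rewrite /level_row; move: (c - c') (subr0_eq (x := c) (y := c')) => d dE L0.
  (* The de1 column determines [a], [al] and [mu], and de2 then gives [be]. *)
  have [d0 d1 d2 d3] : [/\ d 0 0 = 0, d 0 1 = 0, d 0 2 = 0 & d 0 3 = 0].
    have L1 := congr1 (@e1 R n) L0; have L2 := congr1 (@e2 R n) L0.
    rewrite !of_colsE (_ : e1 0 = 0) in L1; last exact: linear0.
    rewrite !of_colsE (_ : e2 0 = 0) in L2; last exact: linear0.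
    have [_ A B C] := comb_eq0 xM D0 L1; have [_ _ _ D] := comb_eq0 xM D0 L2.
    by rewrite B mul0r subr0 in A; split.
  apply: dE; apply/rowP => j; rewrite [RHS]mxE.
  case: j => [[|[|[|[|//]]]] jlt]; [rewrite -d0|rewrite -d1|rewrite -d2|rewrite -d3];
    congr (d 0 _); exact: val_inj.
split=> // v w; rewrite !memv_image_hyperplane !lE => -[[c ->] lc] [[c' ->] lc'].
move: lc0 lc lc'; rewrite lE !phiE /level_row !dK // => l0 l1 l2.
exact: level_vec_isotropic l0 l1 l2.
Qed.

End Rank_four.

(** * The cross product in R^3 *)

Section Cross_product.
Variable R : realType.
Implicit Types u v w : 'cV[R]_3.

Lemma cross3 u v : (cross u v 0 0 = u 1 0 * v 2 0 - u 2 0 * v 1 0) *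
  (cross u v 1 0 = u 2 0 * v 0 0 - u 0 0 * v 2 0) *
  (cross u v 2 0 = u 0 0 * v 1 0 - u 1 0 * v 0 0).
Proof.
by split; [split|]; rewrite mxE; congr (u _ _ * v _ _ - u _ _ * v _ _); apply: val_inj.
Qed.

Lemma dot_cross_id u v : dot u (cross u v) = 0.
Proof. by rewrite dot3 !cross3; ring. Qed.

Lemma crossC u v : cross u v = - cross v u.
Proof. by apply/colP => i; rewrite !mxE; ring. Qed.

Lemma dot_cross u v u' v' :
  dot (cross u v) (cross u' v') = dot u u' * dot v v' - dot u v' * dot v u'.
Proof. by rewrite !dot3 !cross3; ring. Qed.

Lemma cross_crossr u v w : cross u (cross v w) = dot u w *: v - dot u v *: w.
Proof.
have entry (i : 'I_3) : (dot u w *: v - dot u v *: w) i 0 =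
  dot u w * v i 0 - dot u v * w i 0 by rewrite !mxE.
apply/colP => i; rewrite entry !dot3.
have [->|[->|->]] : i = 0 \/ i = 1 \/ i = 2.
  by case: i => [[|[|[|//]]] ilt]; [left|right; left|right; right]; apply: val_inj.
all: by rewrite !cross3; ring.
Qed.

End Cross_product.

(** * Contractions of the differential of the momentum map *)

Section Contraction.
Variables (R : realType) (n : nat) (eta : R).

Lemma dot_wedge_mul (f u v g : 'cV[R]_n) :
  dot f (wedge u v *m g) = dot f u * dot v g - dot f v * dot u g.
Proof.
rewrite wedgeDef mulmxBl -!mulmxA !dot_trmx !mul_mx_scalar dotDr dotNr !dotZr.
by ring.
Qed.

Lemma dot_dPhi_mul x v (f g : 'cV[R]_n) : dot f (dPhi eta x v *m g) =
  dot f (p1 v) * dot (e1 x) g - dot f (e1 x) * dot (p1 v) g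
  + (dot f (p1 x) * dot (e1 v) g - dot f (e1 v) * dot (p1 x) g)
  + (dot f (p2 v) * dot (e2 x) g - dot f (e2 x) * dot (p2 v) g
     + (dot f (p2 x) * dot (e2 v) g - dot f (e2 v) * dot (p2 x) g))
  + eta * (dot f (e1 v) * dot (e2 x) g - dot f (e2 x) * dot (e1 v) g
     + (dot f (e1 x) * dot (e2 v) g - dot f (e2 v) * dot (e1 x) g)).
Proof.
have D (A B : 'M[R]_n) : dot f ((A + B) *m g) = dot f (A *m g) + dot f (B *m g).
  by rewrite mulmxDl dotDr.
have Z c (A : 'M[R]_n) : dot f ((c *: A) *m g) = c * dot f (A *m g).
  by rewrite -scalemxAl dotZr.
by rewrite /dPhi D D D !dot_wedge_mul D !dot_wedge_mul Z D !dot_wedge_mul.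
Qed.

End Contraction.

(** * The case n = 3, in the moving frame e1, e2, e3 *)

Section Rank_three.
Variables (R : realType) (eta : R).
Implicit Types (x z v w : ambient R 3).

Definition e3 x : 'cV[R]_3 := cross (e1 x) (e2 x).
Definition sX x : R := dot (p1 x) (e3 x).
Definition sY x : R := dot (p2 x) (e3 x).

Lemma frameE x : TstarV x ->
  (dot (e1 x) (e1 x) = 1) * (dot (e2 x) (e2 x) = 1) * (dot (e3 x) (e3 x) = 1) *
  (dot (e1 x) (e2 x) = 0) * (dot (e2 x) (e1 x) = 0) *
  (dot (e1 x) (e3 x) = 0) * (dot (e3 x) (e1 x) = 0) *
  (dot (e2 x) (e3 x) = 0) * (dot (e3 x) (e2 x) = 0).
Proof.
move=> xM; have g := gramE xM.
have e13 : dot (e1 x) (e3 x) = 0 by rewrite dot_cross_id.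
have e23 : dot (e2 x) (e3 x) = 0.
  by rewrite /e3 crossC dotNr dot_cross_id oppr0.
have e33 : dot (e3 x) (e3 x) = 1 by rewrite dot_cross !g; ring.
by do ![split]; rewrite ?g // dotC.
Qed.

Definition fcomb (z1 z2 z3 : R) x : 'cV[R]_3 := z1 *: e1 x + z2 *: e2 x + z3 *: e3 x.

Lemma dot_fcomb (z1 z2 z3 : R) x (w : 'cV[R]_3) : dot w (fcomb z1 z2 z3 x) =
  z1 * dot w (e1 x) + z2 * dot w (e2 x) + z3 * dot w (e3 x).
Proof. by rewrite /fcomb !dotDr !dotZr. Qed.

Lemma dot_fcombl (z1 z2 z3 : R) x (w : 'cV[R]_3) : dot (fcomb z1 z2 z3 x) w =
  z1 * dot (e1 x) w + z2 * dot (e2 x) w + z3 * dot (e3 x) w.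
Proof. by rewrite /fcomb !dotDl !dotZl. Qed.

Lemma eq_fcomb (y1 y2 y3 z1 z2 z3 : R) x :
  y1 = z1 -> y2 = z2 -> y3 = z3 -> fcomb y1 y2 y3 x = fcomb z1 z2 z3 x.
Proof. by move=> -> -> ->. Qed.

(** A residue [r] orthogonal to the frame has r x e3 = 0 by the double cross product formula,
    whereas |r x e3| = |r| because r is orthogonal to the unit vector e3. *)
Lemma frame_expansion x (w : 'cV[R]_3) : TstarV x ->
  w = fcomb (dot (e1 x) w) (dot (e2 x) w) (dot (e3 x) w) x.
Proof.
move=> xM; have f := frameE xM.
apply/eqP; rewrite -subr_eq0; apply/eqP; set r := w - _.
have r1 : dot (e1 x) r = 0 by rewrite dotDr dotNr dot_fcomb !f; ring.
have r2 : dot (e2 x) r = 0 by rewrite dotDr dotNr dot_fcomb !f; ring.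
have r3 : dot (e3 x) r = 0 by rewrite dotDr dotNr dot_fcomb !f; ring.
apply: dot_eq0; transitivity (dot (cross r (e3 x)) (cross r (e3 x))).
  by rewrite dot_cross f (dotC r (e3 x)) r3; ring.
by rewrite {1}/e3 cross_crossr !(dotC r) r1 r2 !scale0r subr0 dot0l.
Qed.

Lemma p_frameE x : TstarV x ->
  (p1 x = fcomb 0 (u12 x) (sX x) x) * (p2 x = fcomb (- u12 x) 0 (sY x) x).
Proof.
move=> xM; have g := gramE xM; split.
  by rewrite [LHS](frame_expansion _ xM) !g /sX dotC.
by rewrite [LHS](frame_expansion _ xM) !g /sY dotC.
Qed.

(* Here a, al, be are the components de1 . e2, de1 . e3 and de2 . e3. *)
Definition frame_vec x (a al be : R) : ambient R 3 :=
  let u := u12 x in let w := eta - 2 * u in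
  let du := - (sY x * al - sX x * be) / 2 in
  of_cols (fcomb 0 a al x) (fcomb (- a) 0 be x)
    (fcomb (- sX x * al - u * a) (- sX x * be + du) (sY x * a + w * be + u * be) x)
    (fcomb (- sY x * al - du) (- sY x * be - u * a) (- sX x * a - w * al - u * al) x).

Lemma frame_vec_tangent x a al be : TstarV x -> frame_vec x a al be \in tangent x.
Proof.
move=> xM; have f := frameE xM; apply/tangentP; rewrite !of_colsE !(p_frameE xM).
rewrite !(dot_fcomb, dot_fcombl) !f.
by split; split; field.
Qed.

Lemma frame_vec_dPhi x a al be : TstarV x -> dPhi eta x (frame_vec x a al be) = 0.
Proof.
move=> xM; apply/matrixP => i j; rewrite dPhi_entryE [RHS]mxE.
have E (k : 'I_3) (v : ambient R 3) : (v k 0 = e1 v k 0) * (v k 1 = e2 v k 0) *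
   (v k 2 = p1 v k 0) * (v k 3 = p2 v k 0) by rewrite !mxE.
have F (z1 z2 z3 : R) k : fcomb z1 z2 z3 x k 0 = z1 * e1 x k 0 + z2 * e2 x k 0 + z3 * e3 x k 0.
  by rewrite !mxE.
rewrite !E !of_colsE !(p_frameE xM) !F.
by field.
Qed.

Lemma frame_vec_omega x a al be a' al' be' : TstarV x ->
  omega eta (frame_vec x a al be) (frame_vec x a' al' be') =
  sY x * (a * al' - a' * al) - sX x * (a * be' - a' * be)
  - (eta - 2 * u12 x) * (al * be' - al' * be).
Proof.
move=> xM; have f := frameE xM; rewrite /omega !of_colsE.
rewrite !(dot_fcomb, dot_fcombl) !f.
by field.
Qed.

(** On tangent vectors this is g1 dX + g2 dY + g3 dPsi for X = <p1, e3> and Y = <p2, e3>; the [u12]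
    terms come from differentiating e3. *)
Definition frame_diff x (g1 g2 g3 : R) v : R :=
  g1 * (dot (e3 x) (p1 v) - u12 x * dot (e3 x) (e2 v))
  + g2 * (dot (e3 x) (p2 v) + u12 x * dot (e3 x) (e1 v)) + g3 * dPsi x v.

Lemma frame_vec_diff x g1 g2 g3 a al be : TstarV x ->
  frame_diff x g1 g2 g3 (frame_vec x a al be) =
  a * (g1 * sY x - g2 * sX x) + al * (g3 * sY x - g2 * (eta - 2 * u12 x))
  + be * (g1 * (eta - 2 * u12 x) - g3 * sX x).
Proof.
move=> xM; have f := frameE xM; rewrite /frame_diff /dPsi !of_colsE !(p_frameE xM).
rewrite !(dot_fcomb, dot_fcombl) !f.
by field.
Qed.

Lemma frame_vec_isotropic x g1 g2 g3 a0 al0 be0 a al be a' al' be' :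
  TstarV x ->
  frame_diff x g1 g2 g3 (frame_vec x a0 al0 be0) != 0 ->
  frame_diff x g1 g2 g3 (frame_vec x a al be) = 0 ->
  frame_diff x g1 g2 g3 (frame_vec x a' al' be') = 0 ->
  omega eta (frame_vec x a al be) (frame_vec x a' al' be') = 0.
Proof.
move=> xM l0 l l'; apply: (mulIf l0); rewrite mul0r.
pose W := omega (n := 3) eta.
have cyc : W (frame_vec x a al be) (frame_vec x a' al' be')
    * frame_diff x g1 g2 g3 (frame_vec x a0 al0 be0)
  + W (frame_vec x a' al' be') (frame_vec x a0 al0 be0)
    * frame_diff x g1 g2 g3 (frame_vec x a al be)
  + W (frame_vec x a0 al0 be0) (frame_vec x a al be)
    * frame_diff x g1 g2 g3 (frame_vec x a' al' be') = 0.
  by rewrite /W !frame_vec_omega // !frame_vec_diff //; ring.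
by move: cyc; rewrite l l' !mulr0 !addr0.
Qed.

(** The frame replaces any rank condition on the momenta: six tangency equations and three
    contractions of dPhi determine the twelve components of [v] up to three parameters. *)
Lemma tangent_dPhi_frame_vec x v : TstarV x ->
  v \in tangent x -> dPhi eta x v = 0 ->
  v = frame_vec x (dot (e2 x) (e1 v)) (dot (e3 x) (e1 v)) (dot (e3 x) (e2 v)).
Proof.
move=> xM /tangentP tv vPhi; have f := frameE xM.
have C g h : dot g (dPhi eta x v *m h) = 0 by rewrite vPhi mul0mx dotC dot0l.
have C12 := C (e1 x) (e2 x); have C31 := C (e3 x) (e1 x); have C32 := C (e3 x) (e2 x).
move: tv C12 C31 C32; rewrite !dot_dPhi_mul !(p_frameE xM).
rewrite !(dot_fcomb, dot_fcombl) !f.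
have O (w : 'cV[R]_3) : (dot w (e1 x) = dot (e1 x) w) * (dot w (e2 x) = dot (e2 x) w) *
  (dot w (e3 x) = dot (e3 x) w) by split; [split|]; exact: dotC.
rewrite !(O (e1 v)) !(O (e2 v)) !(O (p1 v)) !(O (p2 v)).
move=> tv C12 C31 C32; apply: eq_cols; rewrite !of_colsE [LHS](frame_expansion _ xM);
  apply: eq_fcomb; move: tv C12 C31 C32; clear;
  move: (u12 x) (sX x) (sY x) => u X Y;
  move: (dot (e1 x) (e1 v)) (dot (e2 x) (e1 v)) (dot (e3 x) (e1 v)) => v11 v12 v13;
  move: (dot (e1 x) (e2 v)) (dot (e2 x) (e2 v)) (dot (e3 x) (e2 v)) => v21 v22 v23;
  move: (dot (e1 x) (p1 v)) (dot (e2 x) (p1 v)) (dot (e3 x) (p1 v)) => v31 v32 v33;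
  move: (dot (e1 x) (p2 v)) (dot (e2 x) (p2 v)) (dot (e3 x) (p2 v)) => v41 v42 v43;
  move=> [[t1 t2 t3] [t4 t5 t6]] s1 s2 s3;
  have E : v21 = - v12 by [lra]; subst v11 v21 v22; lra.
Qed.

Definition frame_row x (c : 'rV[R]_3) := frame_vec x (c 0 0) (c 0 1) (c 0 2).

Lemma frame_row_linear x : linear (frame_row x).
Proof.
have F (z1 z2 z3 : R) k : fcomb z1 z2 z3 x k 0 = z1 * e1 x k 0 + z2 * e2 x k 0 + z3 * e3 x k 0.
  by rewrite !mxE.
by move=> c s t; rewrite /frame_row !mxE; apply: eq_cols;
  rewrite ?(e1_lin, e2_lin, p1_lin, p2_lin) !of_colsE;
  apply/colP => i; rewrite matrix_linE !F; field.
Qed.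

Lemma rank_three_isotropic_polar (K : ambient R 3 -> R) x (g1 g2 g3 : R) :
  TstarV x ->
  (forall v, v \in tangent x -> 'd K x v = frame_diff x g1 g2 g3 v) ->
  (g1 * sY x - g2 * sX x) ^+ 2 + (g3 * sY x - g2 * (eta - 2 * u12 x)) ^+ 2
    + (g1 * (eta - 2 * u12 x) - g3 * sX x) ^+ 2 != 0 ->
  exists2 S, isotropic_polar eta K x S & \dim S = 2%N.
Proof.
move=> xM dK coef0.
have frameT a al be : frame_vec x a al be \in tangent x by exact: frame_vec_tangent.
pose phi : 'Hom('rV[R]_3, ambient R 3) := linfun (frame_row x).
pose l : 'Hom(ambient R 3, R^o) := linfun ('d K x : _ -> R^o).
have phiE c : phi c = frame_row x c by rewrite linfunE //; exact: frame_row_linear.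
have lE v : l v = 'd K x v by rewrite lfunE.
have memS v : v \in (phi @: lker (l \o phi))%VS <->
    [/\ v \in tangent x, dPhi eta x v = 0 & 'd K x v = 0].
  rewrite memv_image_hyperplane lE; split=> [[[c ->] lv]|[vT vPhi lv]].
    by split=> //; rewrite phiE; [exact: frameT|exact: frame_vec_dPhi].
  split=> //.
  exists (\row_j [:: dot (e2 x) (e1 v); dot (e3 x) (e1 v); dot (e3 x) (e2 v)]`_j).
  by rewrite phiE /frame_row !mxE [LHS](tangent_dPhi_frame_vec xM vT vPhi).
have [c0 lc0] : exists c0, l (phi c0) != 0.
  have := coef0; rewrite !paddr_eq0 ?addr_ge0 ?sqr_ge0 // !negb_and !sqrf_eq0.
  move=> /orP[/orP[ca|cal]|cbe];
    [exists (delta_mx 0 0)|exists (delta_mx 0 1)|exists (delta_mx 0 2)];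
    rewrite lE phiE /frame_row !mxE /= dK // frame_vec_diff // !mul0r !mul1r.
  - by rewrite !addr0.
  - by rewrite add0r addr0.
  - by rewrite !add0r.
exists (phi @: lker (l \o phi))%VS; last first.
  rewrite (dim_image_hyperplane (u0 := c0)) // ?dim_matrix //.
  apply/lker0P => c c'; rewrite !phiE => cc'.
  have f := frameE xM.
  have E k : dot (e2 x) (e1 (frame_row x k)) = k 0 0 /\
      dot (e3 x) (e1 (frame_row x k)) = k 0 1 /\ dot (e3 x) (e2 (frame_row x k)) = k 0 2.
    by rewrite !of_colsE !dot_fcomb !f; split; [|split]; ring.
  have [E1 [E2 E3]] := E c; have [E1' [E2' E3']] := E c'.
  rewrite cc' in E1 E2 E3; apply/rowP => j.
  case: j => [[|[|[|//]]] jlt].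
  - rewrite (_ : Ordinal jlt = 0) -?E1 -?E1' //; exact: val_inj.
  - rewrite (_ : Ordinal jlt = 1) -?E2 -?E2' //; exact: val_inj.
  - rewrite (_ : Ordinal jlt = 2) -?E3 -?E3' //; exact: val_inj.
split=> // v w; rewrite !memv_image_hyperplane !lE => -[[c ->] lc] [[c' ->] lc'].
move: lc0 lc lc'; rewrite lE !phiE /frame_row !dK // => l0 l1 l2.
exact: frame_vec_isotropic l0 l1 l2.
Qed.

(** This brings [Ha] with n = 3 under the same analysis as [Hb]. *)
Lemma inv_diff_frame_diff x v (h1 h2 h3 h4 : R) : TstarV x -> v \in tangent x ->
  inv_diff x h1 h2 h3 h4 v = frame_diff x (h1 * sX x + h3 * sY x)
    (h2 * sY x + h3 * sX x) (h4 - (h1 + h2) / 2 * u12 x) v.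
Proof.
move=> xM /tangentP; have f := frameE xM.
rewrite /inv_diff /frame_diff /dPsi !(p_frameE xM) !(dot_fcomb, dot_fcombl).
have O (w : 'cV[R]_3) : (dot w (e1 x) = dot (e1 x) w) * (dot w (e2 x) = dot (e2 x) w) *
  (dot w (e3 x) = dot (e3 x) w) by split; [split|]; exact: dotC.
rewrite !(O (e1 v)) !(O (e2 v)).
clear; move: (u12 x) (sX x) (sY x) => u X Y;
  move: (dot (e1 x) (e1 v)) (dot (e2 x) (e1 v)) (dot (e3 x) (e1 v)) => v11 v12 v13;
  move: (dot (e1 x) (e2 v)) (dot (e2 x) (e2 v)) (dot (e3 x) (e2 v)) => v21 v22 v23;
  move: (dot (e1 x) (p1 v)) (dot (e2 x) (p1 v)) (dot (e3 x) (p1 v)) => v31 v32 v33;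
  move: (dot (e1 x) (p2 v)) (dot (e2 x) (p2 v)) (dot (e3 x) (p2 v)) => v41 v42 v43.
move=> [[t1 t2 t3] [t4 t5 t6]]; subst v11 v22.
have E : v21 = - v12 by lra.
subst v21; have E : v31 = - u * v12 - X * v13 by lra.
subst v31; have E : v42 = - u * v12 - Y * v23 by lra.
subst v42; have E : v41 = - (Y * v13) - X * v23 - v32 by lra.
by subst v41; field.
Qed.

End Rank_three.

(** * Completeness *)

Section Differentials.
Variables (R : realType) (n : nat) (eta : R).
Implicit Types (x z v w : ambient R n).

Lemma polynomial_Psi : polynomial_fun (@Psi R n).
Proof. by apply: polynomialB; exact: polynomial_dot. Qed.

Lemma polynomial_Ha (a1 a2 a3 a4 : R) : polynomial_fun (@Ha R n a1 a2 a3 a4).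
Proof.
have C := @polynomial_cst R n; have D := @polynomial_dot R n.
have M := @polynomialM R n.
apply: polynomialD; [apply: polynomialD; [apply: polynomialD|]|].
- exact: M (C _) (D 2 2).
- exact: M (C _) (D 3 3).
- exact: M (C _) (M _ _ (D 2 1) (D 3 0)).
- exact: M (C _) (D 2 3).
Qed.

Lemma diff_Psi x v : 'd (@Psi R n) x v = dPsi x v.
Proof.
exact: (has_diffD (has_diff_dot 0 3 x v) (has_diffN (has_diff_dot 1 2 x v))).2.
Qed.

Lemma diff_Ha (a1 a2 a3 a4 : R) x v : TstarV x ->
  'd (@Ha R n a1 a2 a3 a4) x v = inv_diff x a1 a2 a4 (a3 * u12 x) v.
Proof.
move=> xM; have g := gramE xM; have D a b := has_diff_dot a b x v.
have := (has_diffD (has_diffD (has_diffD (has_diffZ (2^-1 * a1) (D 2 2))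
  (has_diffZ (2^-1 * a2) (D 3 3))) (has_diffZ a3 (has_diffM (D 2 1) (D 3 0))))
  (has_diffZ a4 (D 2 3))).2.
rewrite -/(e1 x) -/(e2 x) -/(p1 x) -/(p2 x) -/(e1 v) -/(e2 v) -/(p1 v) -/(p2 v).
rewrite (dotC (p1 v) (p1 x)) (dotC (p2 v) (p2 x)) (dotC (p1 v) (p2 x)).
rewrite (dotC (p2 v) (e1 x)) (dotC (p2 x) (e1 v)) (dotC (p1 v) (e2 x)) (dotC (p1 x) (e2 v)).
rewrite !g => H; rewrite [LHS]H /inv_diff /dPsi.
by field.
Qed.

Lemma inv_diff_so_act x i j (h1 h2 h3 h4 : R) :
  inv_diff x h1 h2 h3 h4 (so_act i j x) = 0.
Proof.
rewrite /inv_diff /dPsi /e1 /e2 /p1 /p2 !dot_so_actr !dot_so_actl !mxE.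
by ring.
Qed.

Lemma so_invariant_inv_diff (K : ambient R n -> R) h1 h2 h3 h4 :
  (forall x v, TstarV x -> v \in tangent x ->
     'd K x v = inv_diff x (h1 x) (h2 x) (h3 x) (h4 x) v) -> so_invariant K.
Proof.
by move=> dK x i j xM; rewrite dK ?inv_diff_so_act //; exact: tangent_so_act.
Qed.

(** The Hamiltonian field of an invariant [K] is tangent to the momentum level sets, so it
    annihilates any [H] whose differential vanishes along them. *)
Lemma bracket_level (K H : ambient R n -> R) x : so_invariant K ->
  (forall v, v \in tangent x -> dPhi eta x v = 0 -> 'd H x v = 0) ->
  TstarV x -> bracket eta K H x = 0.
Proof.
move=> invK dH xM; rewrite bracket_skew // bracketE dH ?oppr0 //; first exact: subvsP.
apply/matrixP => i j; rewrite [RHS]mxE -(has_diff_Phi eta i j x _).2 -bracketE.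
by rewrite bracket_skew // bracket_invariant_Phi // oppr0.
Qed.

Lemma bracket_self (K : ambient R n -> R) x : TstarV x -> bracket eta K K x = 0.
Proof.
by move=> xM; move: (bracket eta K K x) (bracket_skew eta K K xM) => b; lra.
Qed.

(* For eta = 0, this is the differential of a/2 <Phi, Phi>. *)
Lemma inv_diff_level (a : R) x v : TstarV x -> v \in tangent x -> dPhi 0 x v = 0 ->
  inv_diff x a a 0 (- a * u12 x) v = 0.
Proof.
move=> xM /tangentP[[t1 t2 t3] _] vPhi; have g := gramE xM.
(* The sum is <Phi, dPhi v> for eta = 0, because <p ^ e, A> = <p, A e> for antisymmetric A. *)
have : dot (p1 x) (dPhi 0 x v *m e1 x) + dot (p2 x) (dPhi 0 x v *m e2 x) = 0.
  by rewrite vPhi !mul0mx !(dotC _ 0) !dot0l addr0.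
rewrite !dot_dPhi_mul !g.
rewrite (dotC (e1 v) (e1 x)) (dotC (e2 v) (e2 x)) t1 t2.
rewrite (dotC (e1 v) (e2 x)) (dotC (e2 v) (e1 x)).
rewrite (dotC (p1 v) (e1 x)) (dotC (p1 v) (e2 x)) (dotC (p2 v) (e1 x)) (dotC (p2 v) (e2 x)).
rewrite /inv_diff /dPsi (dotC (e1 v) (p2 x)) (dotC (e2 v) (p1 x)) => S.
have E : dot (e2 x) (e1 v) = - dot (e1 x) (e2 v) by lra.
by apply: (etrans _ (etrans (congr1 ( *%R a) S) (mulr0 a))); rewrite E; ring.
Qed.

End Differentials.

(** * Points with prescribed invariants in each fibre *)

Section Fibre_points.
Variables (R : realType).

Lemma exists_unit_orthogonal n (s : seq 'cV[R]_n) : (size s < n)%N ->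
  exists2 r : 'cV[R]_n, forall w, w \in s -> dot w r = 0 & dot r r = 1.
Proof.
move=> sn; pose M : 'M[R]_(size s, n) := \matrix_(i, j) (nth 0 s i) j 0.
have [r Mr rr] := exists_unit_normal M sn; exists r => // w ws.
have ilt : (index w s < size s)%N by rewrite index_mem.
have := congr1 (fun A : 'cV_(size s) => A (Ordinal ilt) 0) Mr.
rewrite mxE [RHS]mxE => <-; apply: eq_bigr => j _.
by rewrite mxE /= nth_index.
Qed.

(** For n > 3 there are orthonormal r1, r2 orthogonal to e1, e2. Taking q1 = r1 and q2 = t r1 + r2
    keeps the Gram determinant equal to 1 for every t. *)
Lemma fibre_point_rank_four n (x : ambient R n) (t u : R) : (3 < n)%N -> TstarV x ->
  exists z, [/\ TstarV z, e1 z = e1 x, e2 z = e2 x &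
    [/\ u12 z = u, sA z = 1, sB z = t ^+ 2 + 1 & sC z = t]].
Proof.
move=> n3 xM; have g := gramE xM.
have [r1 r1P r11] := @exists_unit_orthogonal n [:: e1 x; e2 x] (ltnW n3).
have [r2 r2P r22] := @exists_unit_orthogonal n [:: e1 x; e2 x; r1] n3.
have O1 : (dot (e1 x) r1 = 0) * (dot (e2 x) r1 = 0) * (dot r1 r1 = 1) *
  (dot (e1 x) r2 = 0) * (dot (e2 x) r2 = 0) * (dot r1 r2 = 0) * (dot r2 r2 = 1).
  by do ![split]; rewrite ?r11 ?r22 //; [apply: r1P|apply: r1P|apply: r2P|apply: r2P
    |apply: r2P]; rewrite !inE eqxx ?orbT.
have O := (O1, dotC r1 (e1 x), dotC r1 (e2 x), dotC r2 (e1 x), dotC r2 (e2 x), dotC r2 r1).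
exists (of_cols (e1 x) (e2 x) (u *: e2 x + r1) (- u *: e1 x + (t *: r1 + r2))).
split; rewrite ?of_colsE //.
  apply/TstarVP; rewrite !of_colsE !(dotDl, dotDr, dotZl, dotZr) !O !g.
  by split; split; ring.
rewrite /sA /sB /sC /u12 !of_colsE !(dotDl, dotDr, dotZl, dotZr) !O !g.
by split; ring.
Qed.

Lemma fibre_point_rank_three (x : ambient R 3) (X Y u : R) : TstarV x ->
  exists z, [/\ TstarV z, e1 z = e1 x, e2 z = e2 x &
    [/\ u12 z = u, sX z = X & sY z = Y]].
Proof.
move=> xM; have f := frameE xM.
exists (of_cols (e1 x) (e2 x) (fcomb 0 u X x) (fcomb (- u) 0 Y x)).
split; rewrite ?of_colsE //.
  apply/TstarVP; rewrite !of_colsE !(dot_fcomb, dot_fcombl) !f.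
  by split; split; ring.
rewrite /sX /sY /u12 /e3 !of_colsE -/(e3 x) !(dot_fcomb, dot_fcombl) !f.
by split; ring.
Qed.

End Fibre_points.

(** * Genericity outside the exceptional case *)

Section Generic_rank.
Variables (R : realType) (eta : R).

Lemma polynomial_u12 n : polynomial_fun (@u12 R n).
Proof. exact: polynomial_dot. Qed.

Lemma polynomial_sA n : polynomial_fun (@sA R n).
Proof.
apply: polynomialB; [exact: polynomial_dot|apply: polynomialX; exact: polynomial_u12].
Qed.

Lemma polynomial_sB n : polynomial_fun (@sB R n).
Proof.
apply: polynomialB; [exact: polynomial_dot|apply: polynomialX; exact: polynomial_u12].
Qed.

Lemma polynomial_sC n : polynomial_fun (@sC R n).
Proof. exact: polynomial_dot. Qed.

(** The excluded coefficients are those of the differential of (h1 / 2) <Phi, Phi>, which vanishes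
    along the level sets. *)
Lemma generic_rank_four n (K : ambient R n -> R) (h1 h2 h3 k k0 : R) : (3 < n)%N ->
  (forall x v, TstarV x -> v \in tangent x ->
     'd K x v = inv_diff x h1 h2 h3 (k * u12 x + k0) v) ->
  ~ [/\ h3 = 0, h1 = h2, k = - h1 & k0 = eta * h1] ->
  generically (fun x => exists2 S, isotropic_polar eta K x S & \dim S = 3%N).
Proof.
move=> n3 dK nonexc.
have [t [u tu]] : exists t u : R, (h1 - h2) * t + h3 * t ^+ 2 != 0 \/
    - (eta - 2 * u) * (h2 * t + h3) + (k * u + k0 - (h1 + h2) / 2 * u) * t != 0.
  apply: contrapT => no; apply: nonexc.
  have E (t u : R) : (h1 - h2) * t + h3 * t ^+ 2 = 0 /\
      - (eta - 2 * u) * (h2 * t + h3) + (k * u + k0 - (h1 + h2) / 2 * u) * t = 0.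
    split; apply/eqP/negPn/negP => H; apply: no; exists t, u; [by left|by right].
  (* The values t = 1 and t = -1 give h3 = 0 and h1 = h2; then u = 0 gives k0 and u = 1 gives k. *)
  have [E1 E3] := E 1 0; have [E2 _] := E (-1) 0; have [_ E4] := E 1 1.
  have H3 : h3 = 0 by lra.
  have H12 : h1 = h2 by lra.
  by rewrite H3 -H12 in E3 E4 *; split=> //; lra.
have PU := @polynomial_u12 n; have PA := @polynomial_sA n.
have PB := @polynomial_sB n; have PC := @polynomial_sC n.
apply: (@generically_polynomial _ _ (fun x : ambient R n =>
  (sA x * sB x - sC x ^+ 2) * (level_coef_a x h1 h2 h3 ^+ 2
     + level_coef_al eta x h1 h2 h3 (k * u12 x + k0) ^+ 2))).
- rewrite /level_coef_a /level_coef_al.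
  by do ?[exact: polynomial_cst|exact: PU|exact: PA|exact: PB|exact: PC|apply: polynomialX
    |apply: polynomialB|apply: polynomialD|apply: polynomialM|apply: polynomialN].
- move=> x xM; have [z [zM z1 z2 [zu zA zB zC]]] := fibre_point_rank_four t u n3 xM.
  exists z; split=> //; rewrite mulf_neq0 //.
    by rewrite zA zB zC mul1r addrAC subrr add0r oner_neq0.
  rewrite paddr_eq0 ?sqr_ge0 // negb_and !sqrf_eq0 /level_coef_a /level_coef_al.
  rewrite zu zA zB zC mulr1 addrK.
  by apply/orP; case: tu; [left|right].
- move=> x xM; rewrite mulf_eq0 negb_or => /andP[D0 coef0].
  apply: (rank_four_isotropic_polar xM D0 _ coef0) => v vT; exact: dK.
Qed.

Lemma polynomial_e3 (a : 'I_4) : polynomial_fun (fun x : ambient R 3 => dot (col a x) (e3 x)).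
Proof.
rewrite (_ : (fun x => _) = fun x : ambient R 3 =>
  x 0 a * (x 1 0 * x 2 1 - x 2 0 * x 1 1) + x 1 a * (x 2 0 * x 0 1 - x 0 0 * x 2 1)
  + x 2 a * (x 0 0 * x 1 1 - x 1 0 * x 0 1)); last first.
  by apply/funext => x; rewrite dot3 !cross3 !mxE.
have C i b := @polynomial_coord R 3 i b.
by do ?[apply: polynomialB|apply: polynomialD|apply: polynomialM|exact: C].
Qed.

(** Since Psi = -2 u, the differential is that of a quadratic form in X, Y, Psi plus k0 Psi, which
    covers [Hb], [Ha] and [Psi]. The excluded case is (b1 / 2) (X^2 + Y^2 + (Psi + eta)^2) up to a
    constant, that is, a multiple of <Phi, Phi>. *)
Lemma generic_rank_three (K : ambient R 3 -> R) (b1 b2 b3 b4 b5 b6 k0 : R) :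
  (forall x v, TstarV x -> v \in tangent x ->
     'd K x v = frame_diff x (b1 * sX x + b4 * sY x - 2 * b5 * u12 x)
       (b2 * sY x + b4 * sX x - 2 * b6 * u12 x)
       (k0 - 2 * b3 * u12 x + b5 * sX x + b6 * sY x) v) ->
  ~ ([/\ b1 = b2, b3 = b1, b4 = 0, b5 = 0 & b6 = 0] /\ k0 = eta * b1) ->
  generically (fun x => exists2 S, isotropic_polar eta K x S & \dim S = 2%N).
Proof.
move=> dK nonexc.
pose g1 (X Y u : R) := b1 * X + b4 * Y - 2 * b5 * u.
pose g2 (X Y u : R) := b2 * Y + b4 * X - 2 * b6 * u.
pose g3 (X Y u : R) := k0 - 2 * b3 * u + b5 * X + b6 * Y.
pose Q (X Y u : R) := (g1 X Y u * Y - g2 X Y u * X) ^+ 2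
  + (g3 X Y u * Y - g2 X Y u * (eta - 2 * u)) ^+ 2
  + (g1 X Y u * (eta - 2 * u) - g3 X Y u * X) ^+ 2.
have [X [Y [u Q0]]] : exists X Y u : R, Q X Y u != 0.
  apply: contrapT => no; apply: nonexc.
  have E (X Y u : R) : [/\ g1 X Y u * Y - g2 X Y u * X = 0,
      g3 X Y u * Y - g2 X Y u * (eta - 2 * u) = 0
    & g1 X Y u * (eta - 2 * u) - g3 X Y u * X = 0].
    have /eqP : Q X Y u = 0 by apply/eqP/negPn/negP => H; apply: no; exists X, Y, u.
    rewrite /Q !paddr_eq0 ?addr_ge0 ?sqr_ge0 // !sqrf_eq0.
    by move=> /andP[/andP[/eqP-> /eqP->] /eqP->].
  (* These values of (X, Y, u) isolate b4, b6, b5 and b1 - b2 in turn; the second identity then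
     yields k0 and b3. *)
  have [A1 _ _] := E 1 0 0; have [A2 _ _] := E 1 0 1; have [A3 _ _] := E 0 1 1.
  have [A4 _ _] := E 1 1 0.
  rewrite /g1 /g2 in A1 A2 A3 A4.
  have H4 : b4 = 0 by lra.
  have H6 : b6 = 0 by lra.
  have H5 : b5 = 0 by lra.
  have H12 : b1 = b2 by lra.
  have [_ B1 _] := E 0 1 0; have [_ B2 _] := E 0 1 1.
  rewrite /g2 /g3 H4 H5 H6 -H12 in B1 B2.
  split; last by lra.
  by split=> //; lra.
apply: (@generically_polynomial _ _ (fun x : ambient R 3 => Q (sX x) (sY x) (u12 x))).
- have PX : polynomial_fun (@sX R) := @polynomial_e3 2.
  have PY : polynomial_fun (@sY R) := @polynomial_e3 3.
  have PU := @polynomial_u12 3.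
  rewrite /Q /g1 /g2 /g3.
  by do ?[exact: polynomial_cst|exact: PX|exact: PY|exact: PU|apply: polynomialX
    |apply: polynomialB|apply: polynomialD|apply: polynomialM].
- move=> x xM; have [z [zM z1 z2 [zu zX zY]]] := fibre_point_rank_three X Y u xM.
  by exists z; rewrite zu zX zY.
- move=> x xM Qx; apply: (rank_three_isotropic_polar xM _ Qx) => v vT; exact: dK.
Qed.

End Generic_rank.

(** * The differential of [Hb] *)

Section Hamiltonian_b.
Variables (R : realType) (b1 b2 b3 b4 b5 b6 : R).
Implicit Types (x v : ambient R 3).

Lemma polynomial_Hb : polynomial_fun (Hb b1 b2 b3 b4 b5 b6).
Proof.
have PX := @polynomial_e3 R 2; have PY := @polynomial_e3 R 3.
have PP := @polynomial_Psi R 3.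
by rewrite /Hb; do ?[exact: polynomial_cst|exact: PX|exact: PY|exact: PP
  |apply: polynomialX|apply: polynomialD|apply: polynomialM].
Qed.

Lemma has_diff_e3 (a : 'I_4) x v :
  has_diff (fun y : ambient R 3 => dot (col a y) (e3 y)) x v
    (dot (e3 x) (col a v) + dot (col a x) (cross (e1 v) (e2 x) + cross (e1 x) (e2 v))).
Proof.
rewrite (_ : (fun x => _) = fun x : ambient R 3 =>
  x 0 a * (x 1 0 * x 2 1 - x 2 0 * x 1 1) + x 1 a * (x 2 0 * x 0 1 - x 0 0 * x 2 1)
  + x 2 a * (x 0 0 * x 1 1 - x 1 0 * x 0 1)); last first.
  by apply/funext => y; rewrite dot3 !cross3 !mxE.
have M i b j c := has_diffM (has_diff_coord i b x v) (has_diff_coord j c x v).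
have T i j k := has_diffM (has_diff_coord i a x v)
  (has_diffD (M j 0 k 1) (has_diffN (M k 0 j 1))).
apply: has_diff_eq; first exact: has_diffD (has_diffD (T 0 1 2) (T 1 2 0)) (T 2 0 1).
by rewrite dotDr !dot3 !cross3 !mxE; ring.
Qed.

Lemma dot_dcross x v : TstarV x -> v \in tangent x ->
  (dot (p1 x) (cross (e1 v) (e2 x) + cross (e1 x) (e2 v)) = - u12 x * dot (e3 x) (e2 v)) *
  (dot (p2 x) (cross (e1 v) (e2 x) + cross (e1 x) (e2 v)) = u12 x * dot (e3 x) (e1 v)).
Proof.
move=> xM /tangentP[[t1 t2 _] _]; have f := frameE xM.
have c21 w : dot (e2 x) (cross w (e2 x)) = 0 by rewrite dot3 !cross3; ring.
have c22 w : dot (e2 x) (cross (e1 x) w) = - dot (e3 x) w.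
  by rewrite !dot3 !cross3; ring.
have c11 w : dot (e1 x) (cross w (e2 x)) = - dot (e3 x) w.
  by rewrite !dot3 !cross3; ring.
have c31 w : dot (e3 x) (cross w (e2 x)) = dot (e1 x) w by rewrite dot_cross !f; ring.
have c32 w : dot (e3 x) (cross (e1 x) w) = dot (e2 x) w by rewrite dot_cross !f; ring.
rewrite !(p_frameE xM) !dot_fcombl !dotDr c21 c22 c11 c31 c32 dot_cross_id t1 t2.
by split; ring.
Qed.

Lemma diff_Hb x v : TstarV x -> v \in tangent x ->
  'd (Hb b1 b2 b3 b4 b5 b6) x v =
  frame_diff x (b1 * sX x + b4 * sY x - 2 * b5 * u12 x)
       (b2 * sY x + b4 * sX x - 2 * b6 * u12 x)
       (0 - 2 * b3 * u12 x + b5 * sX x + b6 * sY x) v.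
Proof.
move=> xM vT; have dX := has_diff_e3 2 x v; have dY := has_diff_e3 3 x v.
have dP : has_diff (@Psi R 3) x v (dPsi x v).
  by split; [exact: polynomial_differentiable (@polynomial_Psi R 3)|exact: diff_Psi].
rewrite -/(p1 x) -/(p1 v) (dot_dcross xM vT) in dX.
rewrite -/(p2 x) -/(p2 v) (dot_dcross xM vT) in dY.
have PsiE : Psi x = - 2 * u12 x by rewrite /Psi !(gramE xM); ring.
have := (has_diffD (has_diffD (has_diffD (has_diffD (has_diffD
  (has_diffZ (2^-1 * b1) (has_diffM dX dX)) (has_diffZ (2^-1 * b2) (has_diffM dY dY)))
  (has_diffZ (2^-1 * b3) (has_diffM dP dP))) (has_diffZ b4 (has_diffM dX dY)))
  (has_diffZ b5 (has_diffM dP dX))) (has_diffZ b6 (has_diffM dP dY))).2.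
rewrite -/(p1 x) -/(p2 x) -/(sX x) -/(sY x) PsiE => H.
by rewrite [LHS]H /frame_diff; field.
Qed.

End Hamiltonian_b.

(** * Consequences of positive definiteness, and invariance of frame differentials *)

Section Positivity.
Variable R : realType.

Lemma TstarV_unit_momentum n : (2 < n)%N ->
  exists2 x : ambient R n, TstarV x & dot (p1 x) (p1 x) = 1 /\ p2 x = 0.
Proof.
move=> n2.
have [u1 _ u11] := @exists_unit_orthogonal R n [::] (ltnW (ltnW n2)).
have [u2 u2P u22] := @exists_unit_orthogonal R n [:: u1] (ltnW n2).
have [u3 u3P u33] := @exists_unit_orthogonal R n [:: u1; u2] n2.
have u12 : dot u1 u2 = 0 by apply: u2P; rewrite mem_head.
have u13 : dot u1 u3 = 0 by apply: u3P; rewrite mem_head.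
exists (of_cols u1 u2 u3 0); last by rewrite !of_colsE.
apply/TstarVP; rewrite !of_colsE !(dotC _ 0) !dot0l u11 u22 u12 u13.
by rewrite u3P ?inE ?eqxx ?orbT // addr0.
Qed.

(** Positivity of [a1] serves to deduce eta = 0 from eta a1 = 0 in the exceptional case; it is read
    off at a unit p1 orthogonal to e1 and e2, with p2 = 0. *)
Lemma fibre_posdef_Ha n (a1 a2 a3 a4 : R) : (2 < n)%N ->
  fibre_posdef (@Ha R n a1 a2 a3 a4) -> 0 < a1.
Proof.
move=> /TstarV_unit_momentum[x xM [p11 p20]] /(_ x xM).
rewrite /Ha p11 p20 !(dotC _ 0) !dot0l !mulr0 !addr0 mulr1 => pos.
have : 0 < 2^-1 * a1.
  by apply: pos => -[p10 _]; move: p11; rewrite p10 dot0l => /esym/eqP; rewrite oner_eq0.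
by rewrite pmulr_rgt0 // invr_gt0.
Qed.

Lemma fibre_posdef_Hb (b1 b2 b3 b4 b5 b6 : R) :
  fibre_posdef (Hb b1 b2 b3 b4 b5 b6) -> 0 < b1.
Proof.
have [x xM _] := TstarV_unit_momentum (n := 3) isT.
have [z [zM _ _ [zu zX zY]]] := fibre_point_rank_three 1 0 0 xM.
move=> /(_ z zM); have PsiE : Psi z = 0 by rewrite /Psi !(gramE zM) zu; ring.
rewrite /Hb -/(e3 z) -/(sX z) -/(sY z) zX zY PsiE => pos.
have p10 : ~ (p1 z = 0 /\ p2 z = 0).
  by move=> [p10 _]; move: zX; rewrite /sX p10 dot0l => /esym/eqP; rewrite oner_eq0.
by have := pos p10; lra.
Qed.

Lemma frame_diff_so_act (x : ambient R 3) i j (g1 g2 g3 : R) : TstarV x ->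
  frame_diff x g1 g2 g3 (so_act i j x) = 0.
Proof.
move=> xM; rewrite /frame_diff -[dPsi _ _]mul1r.
have := inv_diff_so_act x i j 0 0 0 1; rewrite /inv_diff !mul0r !add0r => ->.
rewrite {1}/p1 {1}/p2 {1}/e1 {1}/e2 !dot_so_actr.
have F k : (x k 2 = u12 x * x k 1 + sX x * e3 x k 0) * (x k 3 = - u12 x * x k 0 + sY x * e3 x k 0).
  split; [transitivity (p1 x k 0)|transitivity (p2 x k 0)]; try by rewrite mxE.
    by rewrite (p_frameE xM).1 !mxE mul0r add0r.
  by rewrite (p_frameE xM).2 !mxE mul0r addr0.
by rewrite !F; ring.
Qed.

End Positivity.

(** * Genericity for [Psi], [Ha] and [Hb] *)

Section Completeness.
Variables (R : realType) (eta : R).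

Lemma diff_Psi_inv_diff n (x v : ambient R n) :
  'd (@Psi R n) x v = inv_diff x 0 0 0 (0 * u12 x + 1) v.
Proof. by rewrite diff_Psi /inv_diff; ring. Qed.

Lemma diff_Psi_frame_diff (x v : ambient R 3) :
  'd (@Psi R 3) x v = frame_diff x (0 * sX x + 0 * sY x - 2 * 0 * u12 x)
    (0 * sY x + 0 * sX x - 2 * 0 * u12 x) (1 - 2 * 0 * u12 x + 0 * sX x + 0 * sY x) v.
Proof. by rewrite diff_Psi /frame_diff; ring. Qed.

Lemma so_invariant_Psi n : so_invariant (@Psi R n).
Proof.
apply: (so_invariant_inv_diff (h1 := fun=> 0) (h2 := fun=> 0) (h3 := fun=> 0)
  (h4 := fun x => 0 * u12 x + 1)) => x v _ _; exact: diff_Psi_inv_diff.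
Qed.

Lemma generic_Psi n : (2 < n)%N ->
  generically (fun x : ambient R n => exists2 S, isotropic_polar eta (@Psi R n) x S
    & \dim S = if n == 3%N then 2%N else 3%N).
Proof.
rewrite leq_eqVlt; case: eqP => [<- _|n3 /= n4].
  rewrite eqxx; apply: (generic_rank_three (fun x v _ _ => diff_Psi_frame_diff x v)).
  by case=> _ /eqP; rewrite mulr0 oner_eq0.
rewrite ifN; last by apply/eqP => /esym.
apply: (generic_rank_four n4 (fun x v _ _ => diff_Psi_inv_diff x v)).
by case=> _ _ _ /eqP; rewrite mulr0 oner_eq0.
Qed.

Lemma so_invariant_Ha n (a1 a2 a3 a4 : R) : so_invariant (@Ha R n a1 a2 a3 a4).
Proof.
apply: (so_invariant_inv_diff (h1 := fun=> a1) (h2 := fun=> a2) (h3 := fun=> a4)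
  (h4 := fun x => a3 * u12 x)) => x v xM _; exact: diff_Ha.
Qed.

Lemma so_invariant_Hb (b1 b2 b3 b4 b5 b6 : R) : so_invariant (Hb b1 b2 b3 b4 b5 b6).
Proof.
move=> x i j xM; rewrite diff_Hb //; last exact: tangent_so_act.
exact: frame_diff_so_act.
Qed.

Lemma generic_Ha n (a1 a2 a3 a4 : R) : (2 < n)%N -> 0 < a1 ->
  ~ [/\ eta = 0, a1 = a2, a3 = - a1 & a4 = 0] ->
  generically (fun x => exists2 S, isotropic_polar eta (@Ha R n a1 a2 a3 a4) x S
    & \dim S = if n == 3%N then 2%N else 3%N).
Proof.
move=> + a1_gt0 nonexc; have eta0 : 0 = eta * a1 -> eta = 0.
  by move=> /esym/eqP; rewrite mulf_eq0 (gt_eqF a1_gt0) orbF => /eqP.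
rewrite leq_eqVlt; case: eqP => [<- _|n3 /= n4].
  (* The third coefficient solves a3 u - (a1 + a2) u / 2 = -2 b3 u, which matches the coefficients
     of dPsi. *)
  rewrite eqxx; apply: (@generic_rank_three _ _ _ a1 a2 (((a1 + a2) / 2 - a3) / 2) a4 0 0 0).
    move=> x v xM vT; rewrite diff_Ha // inv_diff_frame_diff //.
    by congr (frame_diff x _ _ _ v); field.
  move=> [[a12 a13 a40 _ _] /eta0 e0]; apply: nonexc; split=> //.
  by rewrite -a12 in a13; lra.
rewrite ifN; last by apply/eqP => /esym.
apply: (@generic_rank_four _ _ _ _ a1 a2 a4 a3 0 n4).
  by move=> x v xM vT; rewrite diff_Ha // addr0.
by move=> [a40 a12 a3E /eta0 e0]; apply: nonexc.
Qed.

Lemma generic_Hb (b1 b2 b3 b4 b5 b6 : R) : 0 < b1 ->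
  ~ (eta = 0 /\ [/\ b1 = b2, b3 = b1, b4 = 0, b5 = 0 & b6 = 0]) ->
  generically (fun x => exists2 S, isotropic_polar eta (Hb b1 b2 b3 b4 b5 b6) x S
    & \dim S = 2%N).
Proof.
move=> b1_gt0 nonexc; apply: (generic_rank_three (@diff_Hb R b1 b2 b3 b4 b5 b6)).
move=> [E /esym/eqP]; rewrite mulf_eq0 (gt_eqF b1_gt0) orbF => /eqP e0.
exact: nonexc.
Qed.

End Completeness.

Unset Implicit Arguments.

Theorem theorem1 (R : realType) (eta : R) :
  (forall (n : nat) (a1 a2 a3 a4 : R),
     (3 <= n)%N ->
     fibre_posdef (@Ha R n a1 a2 a3 a4) ->
     exists F : set ('M[R]_(n, 4) -> R),
       [/\ complete_integrals eta (@Ha R n a1 a2 a3 a4) F,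
           isotropic_dim F (if n == 3%N then 2%N else 3%N)
         & ~ [/\ eta = 0, a1 = a2, a3 = - a1 & a4 = 0] ->
           F = momentum_algebra eta (@Ha R n a1 a2 a3 a4)])
  /\
  (forall b1 b2 b3 b4 b5 b6 : R,
     fibre_posdef (Hb b1 b2 b3 b4 b5 b6) ->
     exists F : set ('M[R]_(3, 4) -> R),
       [/\ complete_integrals eta (Hb b1 b2 b3 b4 b5 b6) F,
           isotropic_dim F 2
         & ~ (eta = 0 /\ [/\ b1 = b2, b3 = b1, b4 = 0, b5 = 0 & b6 = 0]) ->
           F = momentum_algebra eta (Hb b1 b2 b3 b4 b5 b6)]).
Proof.
split=> [n a1 a2 a3 a4 n3 pos|b1 b2 b3 b4 b5 b6 pos].
- have a1_gt0 := fibre_posdef_Ha n3 pos; set H := @Ha R n a1 a2 a3 a4.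
  have polyH : polynomial_fun H by exact: polynomial_Ha.
  have invH : so_invariant H by exact: so_invariant_Ha.
  have [exc|nonexc] := pselect [/\ eta = 0, a1 = a2, a3 = - a1 & a4 = 0].
    (* Here dH vanishes along the momentum level sets, so H adds no independent integral there;
       [Psi] does, and it commutes with H. *)
    have [||F1 F2] := @momentum_algebra_complete R n eta (@Psi R n) (@polynomial_Psi R n)
      H (if n == 3%N then 2%N else 3%N) (@so_invariant_Psi R n) polyH invH.
    + move=> x xM; apply: (bracket_level _ _ xM); first exact: so_invariant_Psi.
      move=> v vT; case: exc => -> a12 a3E a40 vPhi.
      rewrite diff_Ha // -a12 a3E a40; exact: inv_diff_level.
    + exact: generic_Psi.
    + by exists (momentum_algebra eta (@Psi R n)).
  have [||F1 F2] := @momentum_algebra_complete R n eta H polyH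
      H (if n == 3%N then 2%N else 3%N) invH polyH invH.
  + by move=> x; exact: bracket_self.
  + exact: generic_Ha.
  + by exists (momentum_algebra eta H).
- have b1_gt0 := fibre_posdef_Hb pos; set H := Hb b1 b2 b3 b4 b5 b6.
  have polyH : polynomial_fun H by exact: polynomial_Hb.
  have invH : so_invariant H by exact: so_invariant_Hb.
  have [exc|nonexc] := pselect
      (eta = 0 /\ [/\ b1 = b2, b3 = b1, b4 = 0, b5 = 0 & b6 = 0]).
    have [||F1 F2] := @momentum_algebra_complete R 3 eta (@Psi R 3) (@polynomial_Psi R 3)
      H 2 (@so_invariant_Psi R 3) polyH invH.
    + move=> x xM; apply: (bracket_level _ _ xM); first exact: so_invariant_Psi.
      move=> v vT; case: exc => -> [b12 b31 b40 b50 b60] vPhi.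
      (* In the frame, the exceptional dH is b1 / 2 times the differential of <Phi, Phi>. *)
      rewrite diff_Hb //; apply: (etrans _ (inv_diff_level b1 xM vT vPhi)).
      rewrite inv_diff_frame_diff //.
      by rewrite -b12 b31 b40 b50 b60; congr (frame_diff x _ _ _ v); field.
    + exact: (@generic_Psi R eta 3).
    + by exists (momentum_algebra eta (@Psi R 3)).
  have [||F1 F2] := @momentum_algebra_complete R 3 eta H polyH H 2 invH polyH invH.
  + by move=> x; exact: bracket_self.
  + exact: generic_Hb.
  + by exists (momentum_algebra eta H).
Qed.
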